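(* Let $d\ge5$, $\frac{d+1}{d-1}<p<2$ and $\frac p2\le s\le1$. Then for all positive integers $\lambda$ and all $f,g\in\ell^p(\mathbb{Z}^d)$, $$\|T_\lambda(f,g)\|_s \lesssim \lambda^{\frac{d}{2s}-\frac dp}\|f\|_p\|g\|_p.$$
   Context: $\|h\|_s=\big(\sum_{x\in\mathbb{Z}^d}|h(x)|^s\big)^{1/s}$ (a quasi-norm when $s<1$), and $|\cdot|$ is the Euclidean norm. The discrete bilinear spherical average is $$T_\lambda(f,g)(x) = \frac{1}{N(\lambda)} \sum_{\substack{u,v\in\mathbb{Z}^d\\ |u|^2+|v|^2=\lambda}} f(x-u)\,g(x-v),\qquad N(\lambda)=\#\{(u,v)\in\mathbb{Z}^d\times\mathbb{Z}^d:|u|^2+|v|^2=\lambda\}.$$ $X\lesssim Y$ means $X\le CY$ with $C$ depending only on $d,p,s$ (not on $\lambda$, $f$, $g$). *)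

(* Defs.v *)
(* The lattice Z^d is the row-vector type over int; scalars are complex. *)
From mathcomp Require Import all_boot all_order all_algebra complex finmap.
From mathcomp Require Import all_classical all_reals all_analysis.
From mathcomp Require Import zify.

Set Implicit Arguments.
Unset Strict Implicit.
Unset Printing Implicit Defensive.

Import Order.TTheory GRing.Theory Num.Theory.

Local Open Scope classical_set_scope.
Local Open Scope ring_scope.

Definition sqnorm (d : nat) (u : 'rV[int]_d) : int := \sum_(i < d) u 0 i ^+ 2.

Definition bisphere (d lambda : nat) : set ('rV[int]_d * 'rV[int]_d) :=
  [set uv | sqnorm uv.1 + sqnorm uv.2 = lambda%:Z].

Lemma sqnorm_ge0 (d : nat) (u : 'rV[int]_d) : 0 <= sqnorm u.
Proof. by apply: sumr_ge0 => i _; rewrite sqr_ge0. Qed.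

Lemma sqnorm_coord (d : nat) (u : 'rV[int]_d) (i : 'I_d) :
  u 0 i ^+ 2 <= sqnorm u.
Proof.
by rewrite /sqnorm (bigD1 i)//= lerDl; apply: sumr_ge0 => j _; rewrite sqr_ge0.
Qed.

(* Finiteness makes the finitely supported sum and the fset_set cardinal below
   (which default to 0 otherwise) the actual sum and cardinal. *)
Lemma finite_bisphere (d lambda : nat) : finite_set (@bisphere d lambda).
Proof.
pose T := 'rV['I_(2 * lambda).+1]_d.
pose h (k : 'I_(2 * lambda).+1) : int := k%:Z - lambda%:Z.
pose F (w : T) : 'rV[int]_d := map_mx h w.
have hF (u : 'rV[int]_d) : sqnorm u <= lambda%:Z -> exists w, F w = u.
  move=> ule; exists (\row_i inord `|(u 0 i + lambda%:Z)%R|%N).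
  apply/rowP => i; rewrite !mxE /h.
  have := le_trans (sqnorm_coord u i) ule; rewrite expr2 => ui.
  move: ui; move: (u 0 i) => z zle.
  have zlo : - lambda%:Z <= z by nia.
  have zhi : z <= lambda%:Z by nia.
  by rewrite inordK; lia.
apply: (@sub_finite_set _ _ ((fun w : T * T => (F w.1, F w.2)) @` setT)).
  move=> [u v] /= uv.
  have [w1 w1E] : exists w, F w = u.
    by apply: hF; rewrite -uv lerDl sqnorm_ge0.
  have [w2 w2E] : exists w, F w = v.
    by apply: hF; rewrite -uv lerDr sqnorm_ge0.
  by exists (w1, w2) => //=; rewrite w1E w2E.
by apply: finite_image; exact: finite_finset.
Qed.

Definition bisphere_card (d lambda : nat) : nat :=
  #|` fset_set (@bisphere d lambda)|.

Definition bilinear_average (R : realType) (d lambda : nat)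
    (f g : 'rV[int]_d -> R[i]) (x : 'rV[int]_d) : R[i] :=
  (bisphere_card d lambda)%:R^-1 *
  \sum_(uv \in @bisphere d lambda) f (x - uv.1) * g (x - uv.2).

(* Extended-real valued and equal to +oo when the series diverges; normc is the
   modulus as an element of R.  Used for s > 0 only. *)
Definition lsnorm (R : realType) (d : nat) (s : R) (h : 'rV[int]_d -> R[i]) :
    \bar R :=
  poweR (\esum_(x in [set: 'rV[int]_d]) (Normc.normc (h x) `^ s)%:E) s^-1.

Definition in_ls (R : realType) (d : nat) (s : R) (h : 'rV[int]_d -> R[i]) :
    Prop :=
  (lsnorm s h < +oo)%E.

(* Main.v *)
Require Import Defs.
From mathcomp Require Import all_boot all_order all_algebra complex finmap.
From mathcomp Require Import all_classical all_reals all_analysis.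
From mathcomp Require Import zify ring lra.

(** The average is local: [T(f,g)] on a cube of side about [sqrt lambda] only
    sees [f] and [g] on a slightly larger concentric cube.  So it suffices to
    bound [T] from [l^p x l^p] to [l^1] on one cube, to pass to [l^s] on that
    cube by concavity, and to add up over all cubes.

    On one cube, the sum over [x] of [T(f,g)(x)] is a bilinear form in [f] and
    [g] whose kernel at [(y,z)] counts the [x] with
    [|x-y|^2 + |x-z|^2 = lambda], divided by [N(lambda)].  By the
    parallelogram law these [x] satisfy
    [|2x-y-z|^2 = 2 lambda - |y-z|^2], so the kernel is at most
    [r_d(2 lambda - |y-z|^2) / r_2d(lambda)], where [r_k(n)] counts the points
    of [Z^k] with squared norm [n].  If [r_d(n) <= C n^(d/2-1)] and
    [r_2d(n) >= c n^(d-1)], the kernel is [O(lambda^(-d/2))], the inverse of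
    the volume of the cube ([sphere_ratio_le], [sum_bisphere_le],
    [average_box_le]), and Hoelder's inequality finishes the local estimate.
    With [F] and [G] the [p]-th power sums of [|f|] and [|g|] over the cube,
    the global sum of [(F G)^(s/p)] is controlled because [s/p >= 1/2]
    and [F], [G] are at most the full sums [A], [B]: then
    [(FG/AB)^(s/p) <= (F/A + G/B)/2] ([powR_prod_le]).  Cubes centred at all
    lattice points are used instead of a tiling, which replaces the
    decomposition of [Z^d] by translation invariance ([esum_translates]).

    The two counting bounds come from Jacobi's theorem that, for odd [n],
    [4n] is a sum of four squares of odd integers in [16 sigma(n)] ways
    ([jacobi_four_odd_squares]).  Its proof: both sides satisfy the recurrence
    [sum_x (N - 5x^2) a(N - x^2) = 0] over odd [x], with [N = 4n+1].  For the
    count this expresses the symmetry of the five coordinates on a sphere; for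
    [sigma] it is an identity for the solutions of [x^2 + 4yz = N], obtained
    from the involution of Zagier's proof of the two-square theorem
    ([windmill_sum]).

    The upper bound needs at least five squares, since [sigma(n)/n] is
    unbounded: summing [sigma(n - k^2)] over [k] reduces to counting the [k] of
    size at most [S] with [k^2 = n] modulo [f], for each [f <= S], and there are
    [O(S f^(-1/4))] of them ([size_roots_le]), so that [five_squares_le]
    follows from the convergence of the sum of [f^(-5/4)].
    The lower bound fixes all but four coordinates modulo 8 so that the
    remaining four squares add up to 4 modulo 8 ([squares_ge]). *)

Set Implicit Arguments.
Unset Strict Implicit.
Unset Printing Implicit Defensive.
Import Order.TTheory GRing.Theory Num.Theory.
Local Open Scope ring_scope.

(** * Lattice points on spheres *)

Lemma sum_seq_bij (T U : eqType) (V : nmodType) (s : seq T) (t : seq U)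
    (P : pred T) (Q : pred U) (phi : T -> U) (psi : U -> T) (F : U -> V) :
    uniq s -> uniq t ->
    {in s, forall x, P x -> [/\ phi x \in t, Q (phi x) & psi (phi x) = x]} ->
    {in t, forall y, Q y -> [/\ psi y \in s, P (psi y) & phi (psi y) = y]} ->
  \sum_(x <- s | P x) F (phi x) = \sum_(y <- t | Q y) F y.
Proof.
move=> us ut hphi hpsi.
rewrite -big_filter -[RHS]big_filter -(big_map phi predT F).
apply: perm_big; apply: uniq_perm; rewrite ?filter_uniq//.
  rewrite map_inj_in_uniq ?filter_uniq// => x y.
  rewrite !mem_filter => /andP[Px xs] /andP[Py ys] e.
  by have [_ _ <-] := hphi x xs Px; have [_ _ <-] := hphi y ys Py; rewrite e.
move=> y; rewrite mem_filter; apply/mapP/andP => [[x]|[Qy yt]].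
  by rewrite mem_filter => /andP[Px xs] ->; have [] := hphi x xs Px.
have [ps Pp e] := hpsi y yt Qy.
by exists (psi y); rewrite ?e// mem_filter Pp.
Qed.

Definition ints (n : nat) : seq int :=
  [seq j%:Z - n%:Z | j <- iota 0 (2 * n).+1].

Arguments ints : simpl never.

Lemma mem_ints n (k : int) : (k \in ints n) = (`|k| <= n)%N.
Proof.
apply/mapP/idP => [[j]|kn]; first by rewrite mem_iota => jn ->; lia.
by exists `|(k + n%:Z)%R|%N; rewrite ?mem_iota; lia.
Qed.

Lemma ints_uniq n : uniq (ints n).
Proof. by rewrite map_inj_uniq ?iota_uniq// => i j; lia. Qed.

Lemma size_ints n : size (ints n) = (2 * n).+1.
Proof. by rewrite size_map size_iota. Qed.

Definition sumsq (s : seq int) : int := \sum_(k <- s) k ^+ 2.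

Lemma sumsq_cons k s : sumsq (k :: s) = k ^+ 2 + sumsq s.
Proof. by rewrite /sumsq big_cons. Qed.

Lemma sumsq_ge0 s : 0 <= sumsq s.
Proof. by apply: sumr_ge0 => k _; rewrite sqr_ge0. Qed.

(** The lattice points on a sphere form a duplicate-free list, so that counting
    arguments become maps between lists.  The squared radius is an integer
    because the recursion subtracts squares; the test [k ^+ 2 <= n] keeps the
    enumeration small enough to be evaluated. *)
Fixpoint sphere (P : pred int) (d : nat) (n : int) : seq (seq int) :=
  if d is e.+1 then
    [seq k :: s | k <- [seq k <- ints `|n| | P k && (k ^+ 2 <= n)],
                  s <- sphere P e (n - k ^+ 2)]
  else if n == 0 then [:: [::]] else [::].

Arguments sphere : simpl never.

Lemma sphere0 P n : sphere P 0 n = if n == 0 then [:: [::]] else [::].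
Proof. by []. Qed.

Lemma sphereS P d n : sphere P d.+1 n =
  [seq k :: s | k <- [seq k <- ints `|n| | P k && (k ^+ 2 <= n)],
                s <- sphere P d (n - k ^+ 2)].
Proof. by []. Qed.

Lemma mem_sphere P d n s :
  (s \in sphere P d n) = [&& size s == d, all P s & sumsq s == n].
Proof.
elim: d n s => [|d IH] n s.
  rewrite sphere0; case: s => [|k s] /=; last by case: ifP.
  by rewrite /sumsq big_nil eq_sym; case: ifP.
rewrite sphereS; apply/allpairsPdep/idP => [[k [t [kn]]]|].
  move: kn; rewrite mem_filter IH => /andP[/andP[Pk _] _] /and3P[/eqP sz at_ /eqP e] ->.
  by rewrite /= sz eqxx Pk at_ sumsq_cons e addrC subrK eqxx.
case: s => [//|k s] /and3P[/eqP[sz] /andP[Pk aP] /eqP e].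
exists k, s; split=> //.
  rewrite mem_filter Pk mem_ints -e sumsq_cons.
  have := sumsq_ge0 s; move: (sumsq s) => S S0.
  by apply/andP; split; [lia|rewrite -lez_nat; nia].
by rewrite IH sz [all P s]aP eqxx -e sumsq_cons [_ + sumsq s]addrC addrK eqxx.
Qed.

Lemma sphere_uniq P d n : uniq (sphere P d n).
Proof.
elim: d n => [|d IH] n; first by rewrite sphere0; case: ifP.
rewrite sphereS.
apply: allpairs_uniq_dep => [||[k s] [k' s'] _ _ /= [-> ->]]//.
by rewrite filter_uniq// ints_uniq.
Qed.

Lemma sum_sphereS (V : nmodType) P d n (F : seq int -> V) :
  \sum_(s <- sphere P d.+1 n) F s =
  \sum_(k <- ints `|n| | P k && (k ^+ 2 <= n)) \sum_(s <- sphere P d (n - k ^+ 2)) F (k :: s).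
Proof. by rewrite sphereS big_allpairs_dep big_filter. Qed.

Lemma size_sphereS P d n : (size (sphere P d.+1 n) =
  \sum_(k <- ints `|n| | P k && (k ^+ 2 <= n)%R) size (sphere P d (n - k ^+ 2)))%N.
Proof. by rewrite sphereS size_allpairs_dep sumnE big_map big_filter. Qed.

Lemma sphere_size_le (P Q : pred int) d e n m (phi : seq int -> seq int) :
    {in sphere P d n &, injective phi} ->
    {in sphere P d n, forall s, phi s \in sphere Q e m} ->
  (size (sphere P d n) <= size (sphere Q e m))%N.
Proof.
move=> phi_inj hphi; rewrite -(size_map phi).
apply: uniq_leq_size; first by rewrite map_inj_in_uniq// sphere_uniq.
by move=> _ /mapP[s sP ->]; exact: hphi.
Qed.

(** * The windmill identity *)

(** Geometrically a solution of [x^2 + 4yz = N] is a square of side [|x|] with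
    four [y] by [z] rectangles attached to it, the windmills that give Zagier's
    involution its picture. *)
Definition windmills (N : nat) : seq (int * int * int) :=
  [seq t <- [seq (p, z) | p <- [seq (x, y) | x <- ints N, y <- ints N],
                          z <- ints N] |
    [&& 0 < t.1.2, 0 < t.2 & t.1.1 ^+ 2 + 4 * t.1.2 * t.2 == N%:Z]].

Lemma mem_windmills N x y z :
  ((x, y, z) \in windmills N) =
  [&& 0 < y, 0 < z & x ^+ 2 + 4 * y * z == N%:Z].
Proof.
rewrite mem_filter; apply/andP/idP => [[]//|h]; split=> //.
move: h => /and3P[y0 z0 /eqP e].
have yz : y <= y * z /\ z <= y * z by split; nia.
have x2 : x <= x ^+ 2 /\ - x <= x ^+ 2 by split; nia.
apply/allpairsP; exists ((x, y), z); split=> //; last by rewrite mem_ints /=; lia.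
by apply/allpairsP; exists (x, y); split=> //; rewrite mem_ints /=; lia.
Qed.

Lemma windmills_uniq N : uniq (windmills N).
Proof.
apply: filter_uniq; apply: allpairs_uniq; rewrite ?ints_uniq//.
  by apply: allpairs_uniq; rewrite ?ints_uniq// => -[? ?] [? ?] _ _ [-> ->].
by move=> [? ?] [? ?] _ _ [-> ->].
Qed.

(** On the region [R] given by [x + y > z], the reflection
    [iota (x, y, z) = (2z - x, x + y - z, z)] is an involution that changes the
    sign of [H = (x - z)(x + y)(y + z)], so [H] sums to zero over [R].  The map
    [kappa (x, y, z) = (-x, z, y)] preserves [H] and exchanges [R] with its
    complement, as [x + y = z] would make [N = (x + 2y)^2] a square.  Hence [H]
    sums to zero over all windmills, and so does its part even in [x], which is
    the summand. *)
Lemma windmill_sum_sym N : (forall k : int, k ^+ 2 != N%:Z) ->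
  \sum_(t <- windmills N)
     (t.1.1 ^+ 2 - t.1.2 * t.2) * (t.1.2 + t.2) = 0 :> int.
Proof.
move=> Nsq; pose S := windmills N.
pose H (t : int * int * int) : int :=
  (t.1.1 - t.2) * (t.1.1 + t.1.2) * (t.1.2 + t.2).
pose R (t : int * int * int) := t.2 < t.1.1 + t.1.2.
have uS : uniq S := windmills_uniq N.
have HR : \sum_(t <- S | R t) H t = 0.
  pose iota (t : int * int * int) :=
    (2 * t.2 - t.1.1, t.1.2 + t.1.1 - t.2, t.2).
  have hiota : {in S, forall t, R t ->
      [/\ iota t \in S, R (iota t) & iota (iota t) = t]}.
    move=> [[x y] z]; rewrite mem_windmills /R /= => /and3P[y0 z0 /eqP e] xyz.
    split; [|by lia|by rewrite /iota /=; congr (_, _, _); lia].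
    by rewrite mem_windmills; apply/and3P; split=> //=; [lia|rewrite -e; apply/eqP; ring].
  have := sum_seq_bij H uS uS hiota hiota.
  rewrite (eq_bigr (fun t => - H t)); first by
    rewrite sumrN; move: (\sum_(t <- S | R t) H t) => a; lia.
  by move=> [[x y] z] _; rewrite /H /=; ring.
have HRC : \sum_(t <- S | ~~ R t) H t = 0.
  pose kappa (t : int * int * int) := (- t.1.1, t.2, t.1.2).
  have hk (b : bool) : {in S, forall t, R t = b ->
      [/\ kappa t \in S, R (kappa t) = ~~ b & kappa (kappa t) = t]}.
    move=> [[x y] z]; rewrite mem_windmills => /and3P[y0 z0 /eqP e].
    rewrite /R /= => Rb; split; last by rewrite /kappa /= opprK.
      by rewrite mem_windmills y0 z0 /= -e; apply/eqP; ring.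
    rewrite -Rb; have : x + y != z.
      by apply: contra_neq (Nsq (x + 2 * y)) => xyz; rewrite -e -xyz; ring.
    by lia.
  have <- : \sum_(t <- S | R t) H (kappa t) = \sum_(t <- S | ~~ R t) H t.
    apply: (sum_seq_bij (psi := kappa) H) => // t tS.
    - by move=> Rt; have [? -> ?] := hk true t tS Rt.
    - by move=> /negbTE Rt; have [? -> ?] := hk false t tS Rt.
  by rewrite -[RHS]HR; apply: eq_bigr => -[[x y] z] _; rewrite /H /=; ring.
have HS : \sum_(t <- S) H t = 0.
  by rewrite (bigID R) /= HR HRC.
pose rho (t : int * int * int) := (- t.1.1, t.1.2, t.2).
have hrho : {in S, forall t, predT t ->
    [/\ rho t \in S, predT (rho t) & rho (rho t) = t]}.
  move=> [[x y] z]; rewrite !mem_windmills => /and3P[y0 z0 /eqP e] _.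
  by rewrite /rho /= opprK; split; rewrite // y0 z0 -e sqrrN eqxx.
have : \sum_(t <- S) (H t + H (rho t)) = 0.
  by rewrite big_split /= HS (sum_seq_bij H uS uS hrho hrho) HS.
rewrite (eq_bigr (fun t : int * int * int =>
   2 * ((t.1.1 ^+ 2 - t.1.2 * t.2) * (t.1.2 + t.2)))).
  by rewrite -mulr_sumr => /eqP; rewrite mulf_eq0 => /eqP.
by move=> [[x y] z] _; rewrite /H /=; ring.
Qed.

(** The exchange of [y] and [z] identifies the two halves of the symmetric
    sum. *)
Lemma windmill_sum N : (forall k : int, k ^+ 2 != N%:Z) ->
  \sum_(t <- windmills N) (t.1.1 ^+ 2 - t.1.2 * t.2) * t.1.2 = 0 :> int.
Proof.
move=> /windmill_sum_sym h; have uS := windmills_uniq N.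
pose F (t : int * int * int) := (t.1.1 ^+ 2 - t.1.2 * t.2) * t.1.2.
pose swap (t : int * int * int) := (t.1.1, t.2, t.1.2).
have hs : {in windmills N, forall t, predT t ->
    [/\ swap t \in windmills N, predT (swap t) & swap (swap t) = t]}.
  move=> [[x y] z]; rewrite !mem_windmills => /and3P[y0 z0 /eqP e] _.
  by split; rewrite // y0 z0 -e /=; apply/eqP; ring.
have : \sum_(t <- windmills N) (F t + F (swap t)) = 0.
  by rewrite -[RHS]h; apply: eq_bigr => -[[x y] z] _; rewrite /F /=; ring.
by rewrite big_split /= (sum_seq_bij F uS uS hs hs) -mulr2n => /eqP; rewrite mulrn_eq0 => /eqP.
Qed.

Definition sigma (n : nat) : nat := (\sum_(e <- divisors n) e)%N.

Definition oddz (k : int) : bool := odd `|k|%N.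

Lemma oddzP (k : int) : reflect (exists j, k = 2 * j + 1) (oddz k).
Proof.
apply: (iffP idP) => [|[j ->]]; rewrite /oddz; last by lia.
by move=> ok; exists ((k - 1) %/ 2)%Z; lia.
Qed.

Lemma oddz_sqr (k : int) : oddz k -> exists j, k ^+ 2 = 8 * j + 1.
Proof.
move=> /oddzP[j ->].
have [i [->|->]] : exists i, j = 2 * i \/ j = 2 * i + 1.
  by exists (j %/ 2)%Z; lia.
- by exists (2 * i ^+ 2 + i); ring.
- by exists (2 * i ^+ 2 + 3 * i + 1); ring.
Qed.

Lemma evenz_sqr (k : int) : ~~ oddz k -> exists j, k ^+ 2 = 4 * j.
Proof.
rewrite /oddz => ok; have [j ->] : exists j, k = 2 * j.
  by exists (k %/ 2)%Z; lia.
by exists (j ^+ 2); ring.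
Qed.

Definition quarter (N : nat) (x : int) : nat := (`|(N%:Z - x ^+ 2)%R| %/ 4)%N.

(** This is [windmill_sum] with the windmills grouped by [x]: those with a given
    [x] correspond to the divisors [y] of [(N - x^2)/4], and [x] is odd because
    [N] is odd; [N = 5] modulo 8 is not a square. *)
Lemma sigma_recurrence n : odd n ->
  \sum_(x <- ints (4 * n).+1 | oddz x && (x ^+ 2 < (4 * n).+1%:Z))
    ((4 * n).+1%:Z - 5 * x ^+ 2) * (sigma (quarter (4 * n).+1 x))%:Z = 0.
Proof.
set N := (4 * n).+1 => on.
have q4 x : oddz x -> x ^+ 2 < N%:Z ->
    (0 < quarter N x)%N /\ 4 * (quarter N x)%:Z = N%:Z - x ^+ 2.
  by move=> /oddz_sqr[j e]; rewrite /quarter /N e; lia.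
have Nsq k : k ^+ 2 != N%:Z.
  have [/oddz_sqr|/evenz_sqr] := boolP (oddz k) => -[j ->]; rewrite /N; lia.
pose A := [seq x <- ints N | oddz x && (x ^+ 2 < N%:Z)].
pose B := [seq (x, e) | x <- A, e <- divisors (quarter N x)].
have uB : uniq B.
  apply: allpairs_uniq_dep => [|x _|[x e] [x' e'] _ _ /= [-> ->]]//.
    by rewrite filter_uniq ?ints_uniq.
  exact: divisors_uniq.
have memB x e : ((x, e) \in B) =
    [&& oddz x, x ^+ 2 < N%:Z & (e %| quarter N x)%N].
  apply/allpairsPdep/and3P => [[x' [e' [+ + [-> ->]]]]|[ox xN edv]].
    rewrite mem_filter => /andP[/andP[ox xN] _].
    by rewrite -dvdn_divisors//; have [] := q4 x' ox xN.
  have [q0 _] := q4 x ox xN; exists x, e; split=> //.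
    by rewrite mem_filter ox xN mem_ints -lez_nat; nia.
  by rewrite -dvdn_divisors.
pose phi (t : int * nat) : int * int * int :=
  (t.1, t.2%:Z, (quarter N t.1 %/ t.2)%N%:Z).
pose psi (t : int * int * int) : int * nat := (t.1.1, `|t.1.2|%N).
pose F (t : int * int * int) := (t.1.1 ^+ 2 - t.1.2 * t.2) * t.1.2.
have e0 : \sum_(t <- B) F (phi t) = 0.
  rewrite -[RHS](windmill_sum Nsq) -/F.
  apply: (sum_seq_bij (psi := psi) F) => //; first exact: windmills_uniq.
    move=> [x e]; rewrite memB => /and3P[ox xN edv] _; split=> //.
    have [q0 q4x] := q4 x ox xN.
    rewrite mem_windmills /=; have := divnK edv.
    move: (quarter N x %/ e)%N q0 q4x => r; rewrite /N; nia.
  move=> [[x y] z]; rewrite mem_windmills => /and3P[y0 z0 /eqP e] _.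
  have ox : oddz x.
    by apply: contraT => /evenz_sqr[j x2]; move: e; rewrite x2 /N; lia.
  have xN : x ^+ 2 < N%:Z by nia.
  have [q0 q4x] := q4 x ox xN.
  have qyz : quarter N x = (`|y| * `|z|)%N by nia.
  rewrite memB ox xN qyz dvdn_mulr//; split=> //.
  rewrite /phi /psi /= qyz mulKn; last by lia.
  by congr (_, _, _); lia.
(* Since 4 times the quarter q of x is N - x^2, one has -4 (x^2 - q) = N - 5x^2. *)
have : \sum_(t <- B) (-4) * F (phi t) = 0 by rewrite -mulr_sumr e0 mulr0.
rewrite big_allpairs_dep /= big_filter; apply: etrans; apply: eq_bigr => x /andP[ox xN].
have [q0 q4x] := q4 x ox xN.
rewrite -[(sigma _)%:Z]natz natr_sum mulr_sumr; apply: eq_big_seq => e.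
rewrite -dvdn_divisors// => edv; rewrite /F /=; have := divnK edv.
move: (quarter N x %/ e)%N => r e1.
have -> : e%:Z * r%:Z = (quarter N x)%:Z by rewrite -e1; lia.
by rewrite natz [RHS]mulrA; congr (_ * _); lia.
Qed.

(** * Jacobi's theorem for four odd squares *)

Lemma perm_mem_sphere P d n s t :
  perm_eq s t -> (s \in sphere P d n) = (t \in sphere P d n).
Proof.
by move=> st; rewrite !mem_sphere (perm_size st) (perm_all P st) /sumsq
  (perm_big _ st).
Qed.

(** On the sphere in dimension [d + 1] all coordinates have the same second
    moment, by cyclic symmetry, and these moments add up to [N] times the number
    of points. *)
Lemma sphere_recurrence P d (N : nat) :
  \sum_(x <- ints N | P x && (x ^+ 2 <= N%:Z))
    (N%:Z - d.+1%:Z * x ^+ 2) * (size (sphere P d (N%:Z - x ^+ 2)))%:Z = 0.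
Proof.
pose S := sphere P d.+1 N.
have Ssz s : s \in S -> size s = d.+1.
  by rewrite mem_sphere => /and3P[/eqP].
have rotS j s : s \in S -> rot j s \in S /\ rotr j s \in S.
  rewrite (perm_mem_sphere _ _ _ (permEl (perm_rot j s))).
  by rewrite (perm_mem_sphere _ _ _ (permEl (perm_rotr j s))).
have coord j : (j < d.+1)%N ->
    \sum_(s <- S) s`_j ^+ 2 = \sum_(s <- S) s`_0 ^+ 2.
  move=> jd; rewrite -[RHS](sum_seq_bij (phi := rot j) (psi := rotr j)
    (P := predT) _ (sphere_uniq P d.+1 N) (sphere_uniq P d.+1 N)).
  - apply: eq_big_seq => s /Ssz sz.
    by rewrite /rot nth_cat size_drop sz subn_gt0 jd nth_drop addn0.
  - by move=> s sS _; rewrite rotK; have [? _] := rotS j s sS.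
  - by move=> s sS _; rewrite rotrK; have [_ ?] := rotS j s sS.
have e0 : \sum_(s <- S) (N%:Z - d.+1%:Z * s`_0 ^+ 2) = 0.
  rewrite big_split /= sumrN -mulr_sumr; apply/eqP; rewrite subr_eq0; apply/eqP.
  have -> : \sum_(s <- S) N%:Z = \sum_(s <- S) \sum_(0 <= j < d.+1) s`_j ^+ 2.
    apply: eq_big_seq => s sS; rewrite -(Ssz s sS).
    move: sS; rewrite mem_sphere => /and3P[_ _ /eqP <-].
    by rewrite /sumsq (big_nth 0).
  rewrite exchange_big /= (eq_big_nat _ _ (F2 := fun=> \sum_(s <- S) s`_0 ^+ 2)).
    by rewrite sumr_const_nat subn0 -mulr_natl natz.
  by move=> j /andP[_ /coord].
rewrite -[RHS]e0 sum_sphereS; apply: eq_bigr => x _.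
by rewrite /= big_const_seq count_predT iter_addr_0 -mulr_natr natz.
Qed.

Lemma sphere_odd_gt0 d n s : s \in sphere oddz d.+1 n -> 0 < n.
Proof.
rewrite mem_sphere; case: s => [//|k s] /and3P[_ /andP[/oddz_sqr[j ek] _] /eqP].
by rewrite sumsq_cons; have := sumsq_ge0 s; have := sqr_ge0 k; lia.
Qed.

(** Both sides satisfy the same recurrence over the odd [x] with [x^2 < N],
    [N = 4n + 1], so their difference [D] does; by induction only the terms
    [x = 1] and [x = -1] of it survive, with the coefficient [4n - 4]. *)
Lemma jacobi_four_odd_squares n : odd n ->
  size (sphere oddz 4 (4 * n%:Z)) = (16 * sigma n)%N.
Proof.
(* For n = 1 the surviving coefficient vanishes, so this case is evaluated. *)
elim/ltn_ind: n => n IH on; have [->|n1] := eqVneq n 1%N.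
  by rewrite /sigma big_cons big_nil; vm_compute.
set N := (4 * n).+1.
pose Q x := oddz x && (x ^+ 2 < N%:Z).
pose D x : int :=
  (size (sphere oddz 4 (N%:Z - x ^+ 2)))%:Z - 16 * (sigma (quarter N x))%:Z.
have e0 : \sum_(x <- ints N | Q x) (N%:Z - 5 * x ^+ 2) * D x = 0.
  under eq_bigr do rewrite mulrBr [X in _ - X]mulrCA.
  rewrite sumrB -mulr_sumr sigma_recurrence// mulr0 subr0.
  rewrite -[RHS](sphere_recurrence oddz 4 N) [RHS](bigID (fun x => x ^+ 2 < N%:Z)).
  rewrite /= [X in _ = _ + X]big1 ?addr0.
    by apply: eq_bigl => x; rewrite /Q; lia.
  move=> x /andP[_ xN]; case e: (sphere _ _ _) => [|s l]; first by rewrite mulr0.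
  have /sphere_odd_gt0 : s \in sphere oddz 4 (N%:Z - x ^+ 2).
    by rewrite e mem_head.
  by lia.
have q4 x : Q x -> 4 * (quarter N x)%:Z = N%:Z - x ^+ 2 /\ odd (quarter N x).
  by move=> /andP[/oddz_sqr[j e]]; rewrite /quarter /N e; lia.
have D0 x : Q x -> x ^+ 2 != 1 -> D x = 0.
  move=> Qx x1; have [e oq] := q4 x Qx.
  rewrite /D -e IH//; first by lia.
  by have := sqr_ge0 x; move: Qx => /andP[/oddz_sqr[j ej] _]; lia.
have D1 x : x ^+ 2 = 1 -> D x = D 1.
  by move=> x1; rewrite /D /quarter x1 expr1n.
have : D 1 * (4 * n%:Z - 4) = 0.
  move: e0; rewrite (bigID (fun x => x ^+ 2 == 1)) /= [X in _ + X]big1 ?addr0; last first.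
    by move=> x /andP[Qx x1]; rewrite D0// mulr0.
  rewrite (eq_bigr (fun=> D 1 * (4 * n%:Z - 4))); last first.
    by move=> x /andP[Qx /eqP x1]; rewrite D1// x1 mulrC; congr (_ * _); lia.
  rewrite big_const_seq iter_addr_0 => /eqP; rewrite mulrn_eq0 => /orP[|/eqP//].
  rewrite -leqn0 leqNgt -has_count => /hasPn/(_ 1).
  by rewrite mem_ints /Q /oddz expr1n eqxx /N; lia.
move/eqP; rewrite mulf_eq0 => /orP[|]; last by lia.
have [e _] := q4 1 ltac:(by rewrite /Q /oddz expr1n /N; lia).
have qn : quarter N 1 = n by move: e; rewrite expr1n /N; lia.
rewrite /D -e qn; lia.
Qed.

(** * Upper bound for four squares *)

Lemma sum_divisors (V : nmodType) n m (F : nat -> V) : (0 < n <= m)%N ->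
  \sum_(e <- divisors n) F e = \sum_(1 <= e < m.+1 | (e %| n)%N) F e.
Proof.
move=> /andP[n0 nm]; rewrite -[RHS]big_filter; apply: perm_big.
apply: uniq_perm; rewrite ?divisors_uniq ?filter_uniq ?iota_uniq// => e.
rewrite -dvdn_divisors// mem_filter mem_index_iota.
case edv: (e %| n)%N => //=.
by have := dvdn_leq n0 edv; have := dvdn_gt0 n0 edv; lia.
Qed.

Lemma sigma_dvd_le k m : (0 < m)%N -> (k %| m)%N -> (sigma k <= sigma m)%N.
Proof.
move=> m0 km; rewrite /sigma.
rewrite (@sum_divisors nat k m) ?(dvdn_leq m0 km) ?(dvdn_gt0 m0 km)//.
rewrite (@sum_divisors nat m m) ?m0 ?leqnn//.
rewrite big_mkcond [leqRHS]big_mkcond; apply: leq_sum => e _.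
by case ek: (e %| k)%N => //; rewrite (dvdn_trans ek km).
Qed.

Lemma mem_sphere4P P n s : s \in sphere P 4 n ->
  exists a b c d : int, [/\ s = [:: a; b; c; d], [/\ P a, P b, P c & P d]
    & a ^+ 2 + b ^+ 2 + c ^+ 2 + d ^+ 2 = n].
Proof.
rewrite mem_sphere; case: s => [|a [|b [|c [|d [|? ?]]]]]//=.
move=> /andP[/and5P[Pa Pb Pc Pd _] /eqP e]; exists a, b, c, d; split=> //.
by move: e; rewrite /sumsq !big_cons big_nil addr0 !addrA.
Qed.

Lemma mem_sphere4 (P : pred int) (a b c d n : int) :
  ([:: a; b; c; d] \in sphere P 4 n) =
  [&& P a, P b, P c, P d & a ^+ 2 + b ^+ 2 + c ^+ 2 + d ^+ 2 == n].
Proof.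
by rewrite mem_sphere /= /sumsq !big_cons big_nil addr0 !addrA andbT -!andbA.
Qed.

(** The Hadamard transform of a point with odd coordinate sum has odd
    coordinates and four times the squared norm. *)
Lemma four_squares_odd_le m : odd m ->
  (size (sphere predT 4 m) <= 16 * sigma m)%N.
Proof.
move=> om; rewrite -jacobi_four_odd_squares//.
pose phi (s : seq int) := let: (a, b, c, d) := (s`_0, s`_1, s`_2, s`_3) in
  [:: a + b + c + d; a + b - c - d; a - b + c - d; a - b - c + d].
apply: (sphere_size_le (phi := phi)).
  move=> s t /mem_sphere4P[a [b [c [d [-> _ _]]]]].
  move=> /mem_sphere4P[a' [b' [c' [d' [-> _ _]]]]].
  by rewrite /phi /= => -[e1 e2 e3 e4]; congr [:: _; _; _; _]; lia.
move=> s /mem_sphere4P[a [b [c [d [-> _ e]]]]].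
have oabcd : oddz (a + b + c + d).
  apply: contraT => /evenz_sqr[j ej].
  have : (a + b + c + d) ^+ 2 = m%:Z +
      2 * (a * b + a * c + a * d + b * c + b * d + c * d) by rewrite -e; ring.
  by rewrite ej; lia.
rewrite /phi mem_sphere4 /=; apply/and5P; split; rewrite ?/oddz; move: oabcd.
- by [].
- by rewrite /oddz; clear; lia.
- by rewrite /oddz; clear; lia.
- by rewrite /oddz; clear; lia.
- by move=> _; rewrite -e; apply/eqP; ring.
Qed.

Lemma four_squares_double_le m :
  (size (sphere predT 4 m) <= size (sphere predT 4 (2 * m)))%N.
Proof.
pose phi (s : seq int) := let: (a, b, c, d) := (s`_0, s`_1, s`_2, s`_3) in
  [:: a + b; a - b; c + d; c - d].
apply: (sphere_size_le (phi := phi)).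
  move=> s t /mem_sphere4P[a [b [c [d [-> _ _]]]]].
  move=> /mem_sphere4P[a' [b' [c' [d' [-> _ _]]]]].
  by rewrite /phi /= => -[e1 e2 e3 e4]; congr [:: _; _; _; _]; lia.
move=> s /mem_sphere4P[a [b [c [d [-> _ e]]]]].
by rewrite /phi mem_sphere4 /= -e; apply/eqP; ring.
Qed.

(** Squares are 0 or 1 modulo 4, so four squares adding up to a multiple of 4
    are all even or all odd; the even points are halved. *)
Lemma four_squares_quadruple_le (k : nat) :
  (size (sphere predT 4 (4 * k%:Z)) <=
   size (sphere predT 4 k) + size (sphere oddz 4 (4 * k%:Z)))%N.
Proof.
rewrite -(count_predC (all oddz)) addnC leq_add//; last first.
  rewrite -size_filter uniq_leq_size// ?filter_uniq ?sphere_uniq// => s.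
  by rewrite mem_filter !mem_sphere => /andP[-> /and3P[-> _ ->]].
rewrite -size_filter -(size_map (map (fun a => (a %/ 2)%Z))).
have half s : s \in [seq s <- sphere predT 4 (4 * k%:Z) | predC (all oddz) s] ->
    exists a b c d, s = [:: 2 * a; 2 * b; 2 * c; 2 * d] /\
      a ^+ 2 + b ^+ 2 + c ^+ 2 + d ^+ 2 = k%:Z.
  rewrite mem_filter => /andP[abcd /mem_sphere4P[a [b [c [d [es _ e]]]]]].
  move: abcd; rewrite {s}es /= andbT => abcd; suff [a2 b2 c2 d2] :
      [/\ ~~ oddz a, ~~ oddz b, ~~ oddz c & ~~ oddz d].
    move: e; have [a' ->] : exists a', a = 2 * a'.
      by exists (a %/ 2)%Z; move: a2; rewrite /oddz; lia.
    have [b' ->] : exists b', b = 2 * b'.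
      by exists (b %/ 2)%Z; move: b2; rewrite /oddz; lia.
    have [c' ->] : exists c', c = 2 * c'.
      by exists (c %/ 2)%Z; move: c2; rewrite /oddz; lia.
    have [d' ->] : exists d', d = 2 * d'.
      by exists (d %/ 2)%Z; move: d2; rewrite /oddz; lia.
    exists a', b', c', d'; split=> //.
    by apply: (@mulfI _ 4) => //; rewrite -e; ring.
  have sqr4 x : exists j, x ^+ 2 = 4 * j + (oddz x)%:Z.
    case: (boolP (oddz x)) => [/oddz_sqr|/evenz_sqr] [j ->]; last by exists j; lia.
    by exists (2 * j); lia.
  have [q] : exists q : int,
      (oddz a)%:Z + (oddz b)%:Z + (oddz c)%:Z + (oddz d)%:Z = 4 * q.
    move: e; have [[ja ->] [jb ->]] := (sqr4 a, sqr4 b).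
    have [[jc ->] [jd ->]] := (sqr4 c, sqr4 d).
    move: (oddz a)%:Z (oddz b)%:Z (oddz c)%:Z (oddz d)%:Z => oa ob oc od e.
    by exists (k%:Z - ja - jb - jc - jd); lia.
  move: abcd; move: (oddz a) (oddz b) (oddz c) (oddz d); clear.
  by do 4![case=> //=]; lia.
apply: uniq_leq_size.
  rewrite map_inj_in_uniq ?filter_uniq ?sphere_uniq// => s t.
  move=> /half[a [b [c [d [-> _]]]]] /half[a' [b' [c' [d' [-> _]]]]] /=.
  by rewrite !mulKz// => -[-> -> -> ->].
move=> _ /mapP[s /half[a [b [c [d [-> e]]]]] ->] /=.
by rewrite !mulKz// mem_sphere4 /= e.
Qed.

(** Passing from [k] to [4k] adds only the points with odd coordinates, and
    there are none when [k] is even because four odd squares add up to 4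
    modulo 8.  So powers of 2 in [m] cost no more than a factor 2. *)
Lemma four_squares_le m : (0 < m)%N -> (size (sphere predT 4 m) <= 32 * sigma m)%N.
Proof.
elim/ltn_ind: m => m IH m0.
have quad k : (0 < k < m)%N ->
    (size (sphere predT 4 (4 * k%:Z)) <= 32 * sigma k)%N.
  move=> /andP[k0 km]; apply: leq_trans (four_squares_quadruple_le k) _.
  have [ok|ek] := boolP (odd k).
    by rewrite jacobi_four_odd_squares//; have := four_squares_odd_le ok; lia.
  case E: (sphere oddz 4 (4 * k%:Z)) => [|s l].
    by rewrite addn0; exact: IH.
  have : s \in sphere oddz 4 (4 * k%:Z) by rewrite E mem_head.
  move=> /mem_sphere4P[a [b [c [d [_ [/oddz_sqr[ja ea] /oddz_sqr[jb eb]
    /oddz_sqr[jc ec] /oddz_sqr[jd ed]] e]]]]].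
  by move: e ek; rewrite ea eb ec ed; lia.
have [om|em] := boolP (odd m).
  by have := four_squares_odd_le om; lia.
have [k mk] : exists k, m = (2 * k)%N by exists (m %/ 2)%N; lia.
have [ok|ek] := boolP (odd k).
  apply: leq_trans (four_squares_double_le m) _.
  have -> : 2 * m%:Z = 4 * k%:Z by lia.
  apply: leq_trans (quad k _) _; first by lia.
  by rewrite leq_mul2l sigma_dvd_le ?orbT// mk dvdn_mull.
have [l kl] : exists l, k = (2 * l)%N by exists (k %/ 2)%N; lia.
have -> : m%:Z = 4 * l%:Z by lia.
apply: leq_trans (quad l _) _; first by lia.
by rewrite leq_mul2l sigma_dvd_le ?orbT// mk kl !dvdn_mull.
Qed.

(** * Upper bound for five or more squares *)

Lemma floor_sqrt n : exists t, (t ^ 2 <= n < t.+1 ^ 2)%N.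
Proof.
elim: n => [|n [t /andP[tn nt]]]; first by exists 0%N.
have [e|ne] := eqVneq n.+1 (t.+1 ^ 2)%N; [exists t.+1|exists t]; nia.
Qed.

(** Every divisor [e] of [f] has [e] or [f / e] at most [sqrt f]. *)
Lemma size_divisors_le f : (0 < f)%N -> (size (divisors f) ^ 2 <= 4 * f)%N.
Proof.
move=> f0; have [t /andP[tf ft]] := floor_sqrt f.
suff h : (size (divisors f) <= t + t)%N.
  by move: h; move: (size _) => d h; nia.
pose I := iota 1 t.
have -> : (t + t)%N = size (I ++ [seq (f %/ e)%N | e <- I]).
  by rewrite size_cat size_map size_iota.
apply: uniq_leq_size; rewrite ?divisors_uniq// => e; rewrite -dvdn_divisors// => ef.
have e0 := dvdn_gt0 f0 ef; rewrite mem_cat mem_iota.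
have [et|te] := leqP e t; first by rewrite e0 add1n ltnS et.
apply/orP; right; apply/mapP; exists (f %/ e)%N; last by rewrite divnA// mulKn.
by rewrite mem_iota; have := divnK ef; move: (f %/ e)%N => r; nia.
Qed.

Lemma size_multiples_le g S : (0 < g <= S)%N ->
  (g * size [seq a <- ints (2 * S) | (g %| `|a|)%N] <= 5 * S)%N.
Proof.
move=> /andP[g0 gS]; pose t := (2 * S %/ g)%N.
have gt : (g * t <= 2 * S)%N by rewrite mulnC leq_divM.
suff h : (size [seq a <- ints (2 * S) | (g %| `|a|)%N] <= (2 * t).+1)%N.
  by apply: (@leq_trans (g * (2 * t).+1)%N); [rewrite leq_mul2l h orbT|nia].
rewrite -size_ints -(size_map (fun a => (a %/ g%:Z)%Z)).
have gnz : g%:Z != 0 by lia.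
have mult a : (g %| `|a|)%N -> exists q, a = q * g%:Z.
  by move=> ga; exists (a %/ g%:Z)%Z; rewrite divzK.
apply: uniq_leq_size.
  rewrite map_inj_in_uniq ?filter_uniq ?ints_uniq// => a b.
  rewrite !mem_filter => /andP[/mult[q ->] _] /andP[/mult[r ->] _].
  by rewrite !mulzK// => ->.
move=> b /mapP[a + ->]; rewrite mem_filter mem_ints => /andP[/mult[q ->] aS].
rewrite mulzK// mem_ints /t leq_divRL//; move: aS; rewrite abszM; lia.
Qed.

Lemma dvdn_mul_split f a b : (0 < f)%N -> (f %| a * b)%N ->
  exists2 g, (g %| f)%N & (g %| a)%N && (f %/ g %| b)%N.
Proof.
move=> f0 fab; exists (gcdn f a); first exact: dvdn_gcdl.
rewrite dvdn_gcdr /= -(@dvdn_pmul2l (gcdn f a)) ?gcdn_gt0 ?f0//.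
by rewrite mulnC divnK ?dvdn_gcdl// muln_gcdl dvdn_gcd dvdn_mulr.
Qed.

(** A pair [(k, l)] of roots of [k^2 = n] modulo [f] gives a pair
    [(k - l, k + l)] of integers whose product is divisible by [f].  Splitting
    [f] as [g (f / g)] between the two factors leaves at most
    [(5S/g)(5Sg/f)] pairs for each divisor [g], so the squared number of
    roots is at most [25 S^2 d(f) / f], where the divisor count [d(f)] is at
    most [2 sqrt f]. *)
Lemma size_roots_le (f S n : nat) : (0 < f <= S)%N ->
  (size [seq k <- ints S | (f %| `|(n%:Z - k ^+ 2)%R|)%N] ^ 4 * f <= (8 * S) ^ 4)%N.
Proof.
move=> /andP[f0 fS]; set B := [seq k <- _ | _].
pose M g := [seq a <- ints (2 * S) | (g %| `|a|)%N].
pose L := [seq p | g <- divisors f, p <- [seq (a, b) | a <- M g, b <- M (f %/ g)%N]].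
have h1 : (size B ^ 2 <= size L)%N.
  rewrite -mulnn -(size_allpairs (fun k l : int => (k - l, k + l))).
  apply: uniq_leq_size.
    apply: allpairs_uniq; rewrite ?filter_uniq ?ints_uniq// => -[k l] [k' l'] _ _.
    by move=> /= [e1 e2]; congr (_, _); lia.
  move=> p /allpairsP[[k l] [/=]].
  rewrite !mem_filter !mem_ints => /andP[fk kS] /andP[fl lS] ->.
  have fkl : (f %| `|(k - l)%R| * `|(k + l)%R|)%N.
    have /dvdzP[q eq] : n%:Z - k ^+ 2 \in dvdz f%:Z := fk.
    have /dvdzP[r er] : n%:Z - l ^+ 2 \in dvdz f%:Z := fl.
    rewrite -abszM; have -> : (k - l) * (k + l) = (r - q) * f%:Z.
      by rewrite [RHS]mulrBl -eq -er; ring.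
    by rewrite abszM dvdn_mull.
  have [g gf /andP[ga gb]] := dvdn_mul_split f0 fkl.
  apply/allpairsPdep; exists g, (k - l, k + l); split=> //.
    by rewrite -dvdn_divisors.
  apply/allpairsP; exists (k - l, k + l).
  by rewrite !mem_filter !mem_ints /= ga gb; split=> //; move: kS lS; clear; lia.
have h2 : (size L * f <= size (divisors f) * (25 * S ^ 2))%N.
  rewrite size_allpairs_dep sumnE big_map big_distrl /=.
  rewrite -sum1_size big_distrl /= big_seq [leqRHS]big_seq; apply: leq_sum => g.
  rewrite -dvdn_divisors// mul1n size_allpairs => gf.
  have g0 := dvdn_gt0 f0 gf; have gS := leq_trans (dvdn_leq f0 gf) fS.
  have h0 : (0 < f %/ g)%N by rewrite divn_gt0// dvdn_leq.
  have hS : (f %/ g <= S)%N by rewrite (leq_trans (leq_div _ _)).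
  rewrite -[X in (_ * X)%N](divnK gf) -/(M g) -/(M (f %/ g)%N).
  have := @size_multiples_le g S; have := @size_multiples_le (f %/ g)%N S.
  rewrite g0 gS h0 hS -/(M g) -/(M (f %/ g)%N).
  move: (size (M g)) (size (M (f %/ g)%N)) (f %/ g)%N => x y h /(_ isT) e1 /(_ isT) e2.
  have := leq_mul e1 e2; nia.
have h3 := size_divisors_le f0.
move: h1 h2 h3; move: (size B) (size L) (size (divisors f)) => x y z h1 h2 h3.
have h4 : (x ^ 2 * f <= z * (25 * S ^ 2))%N.
  by apply: leq_trans h2; rewrite leq_mul2r h1 orbT.
have h5 : ((x ^ 2 * f) ^ 2 <= (z * (25 * S ^ 2)) ^ 2)%N by rewrite leq_sqr.
have h6 : ((x ^ 4 * f) * f <= (2500 * S ^ 4) * f)%N.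
  have -> : (x ^ 4 * f * f = (x ^ 2 * f) ^ 2)%N by rewrite expnMn -expnM -mulnA mulnn.
  apply: leq_trans h5 _; rewrite expnMn.
  apply: leq_trans (leq_mul h3 (leqnn _)) _; rewrite expnMn -expnM.
  by lia.
move: h6; rewrite leq_pmul2r// expnMn => h6.
by apply: leq_trans h6 _; rewrite leq_mul2r orbC.
Qed.

(** A divisor or its complementary divisor is at most [S], and in each
    complementary pair the sum is controlled by the larger element [m / f].
    Keeping only small [f] is what makes each residue class modulo [f]
    contain many [k] later on. *)
Lemma sigma_le_half (m S : nat) : (0 < m <= S ^ 2)%N ->
  (sigma m <= 2 * \sum_(1 <= f < S.+1 | f %| m) m %/ f)%N.
Proof.
move=> /andP[m0 mS]; pose D := divisors m.
have DE e : (e \in D) = (e %| m)%N by rewrite dvdn_divisors.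
have -> : (\sum_(1 <= f < S.+1 | f %| m) m %/ f =
           \sum_(f <- D | f <= S) m %/ f)%N.
  rewrite -big_filter -[RHS]big_filter; apply: perm_big; apply: uniq_perm;
    rewrite ?filter_uniq ?iota_uniq ?divisors_uniq// => f.
  rewrite !mem_filter mem_index_iota DE.
  by case fm: (f %| m)%N; rewrite ?andbF// (dvdn_gt0 m0 fm) ltnS andbT.
rewrite /sigma (bigID (fun e => m %/ e <= S)%N) mul2n -addnn /= leq_add//.
  have <- : (\sum_(e <- D | m %/ e <= S) m %/ (m %/ e) =
             \sum_(f <- D | f <= S) m %/ f)%N.
    have eK e : (e %| m)%N -> (m %/ (m %/ e) = e)%N.
      by move=> em; rewrite divnA// mulKn.
    apply: (@sum_seq_bij _ _ nat D D _ _ (divn m) (divn m)); rewrite ?divisors_uniq//.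
    - by move=> e; rewrite !DE => em eS; rewrite eK// dvdn_div.
    - by move=> e; rewrite !DE => em eS; rewrite eK// dvdn_div.
  rewrite big_seq_cond [leqRHS]big_seq_cond; apply: leq_sum => e.
  by rewrite DE => /andP[em _]; rewrite divnA// mulKn.
rewrite big_seq_cond [leqRHS]big_seq_cond big_mkcond [leqRHS]big_mkcond.
apply: leq_sum => e _; rewrite DE; case em: (e %| m)%N => //=.
rewrite -ltnNge; case: ltnP => //= Se.
have := divnK em; move: (m %/ e)%N Se => r Sr er.
have eS : (e <= S)%N by nia.
by rewrite eS; lia.
Qed.

(** With [q = f^(1/4)], the term [1/q^5] is dominated by the telescoping
    difference of [4/q]. *)
Lemma sum_inv_root_le (R : rcfType) n :
  \sum_(1 <= f < n.+1) (f%:R * Num.sqrt (Num.sqrt f%:R))^-1 <= 5 :> R.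
Proof.
pose q (f : nat) : R := Num.sqrt (Num.sqrt f%:R).
have q4 f : q f ^+ 4 = f%:R.
  by rewrite /q (exprM _ 2 2) !sqr_sqrtr ?sqrtr_ge0// ler0n.
have q0 f : (0 < f)%N -> 0 < q f by move=> f0; rewrite /q !sqrtr_gt0 ltr0n.
case: n => [|n]; first by rewrite big_nil ler0n.
suff h : \sum_(1 <= f < n.+2) (f%:R * q f)^-1 <= 5 - 4 / q n.+1.
  by apply: le_trans h _; rewrite gerBl divr_ge0 ?ler0n// ltW ?q0.
elim: n => [|n IH]; first by rewrite big_nat1 /q !sqrtr1 mulr1 invr1; lra.
rewrite big_nat_recr//=; apply: le_trans (lerD IH (lexx _)) _.
have [a0 b0] := (q0 n.+1 isT, q0 n.+2 isT).
have ab : q n.+2 ^+ 4 = q n.+1 ^+ 4 + 1 by rewrite !q4 -natr1.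
rewrite -q4; move: (q n.+1) (q n.+2) a0 b0 ab => a b a0 b0 ab.
rewrite -subr_ge0.
have ab' : a <= b by rewrite -(@ler_pXn2r _ 4)// ?nnegrE ?ltW//; lra.
have key : 1 <= 4 * (b - a) * b ^+ 3.
  apply: (@le_trans _ _ (b ^+ 4 - a ^+ 4)); first by rewrite ab addrC addKr.
  have -> : b ^+ 4 - a ^+ 4 = (b - a) * (b ^+ 3 + b ^+ 2 * a + b * a ^+ 2 + a ^+ 3).
    by ring.
  rewrite [4 * _]mulrC -[_ * 4 * _]mulrA ler_wpM2l ?subr_ge0//.
  have h2 : a ^+ 2 <= b ^+ 2 by rewrite ler_pXn2r ?nnegrE ?(ltW a0) ?(ltW b0).
  have h3 : a ^+ 3 <= b ^+ 3 by rewrite ler_pXn2r ?nnegrE ?(ltW a0) ?(ltW b0).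
  have h4 : b ^+ 2 * a <= b ^+ 2 * b by rewrite ler_wpM2l ?sqr_ge0.
  have h5 : b * a ^+ 2 <= b * b ^+ 2 by rewrite ler_wpM2l// ltW.
  by rewrite [b ^+ 3]exprS in h3 *; rewrite [b ^+ 2 * b]mulrC in h4; lra.
have -> : 5 - 4 / b - (5 - 4 / a + (b ^+ 4 * b)^-1) =
    (4 * (b - a) * b ^+ 4 - a) / (a * b ^+ 5).
  by field; rewrite !gt_eqF.
apply: divr_ge0; last by rewrite mulr_ge0 ?exprn_ge0 ?ltW.
rewrite subr_ge0 (le_trans ab')// exprS [X in _ <= X]mulrCA ler_peMr// ltW//.
Qed.

Lemma size_sphereS_ints d (n S : nat) : (n <= S ^ 2)%N ->
  (size (sphere predT d.+1 n) =
   \sum_(k <- ints S | (k ^+ 2 <= n%:Z)%R) size (sphere predT d (n%:Z - k ^+ 2)))%N.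
Proof.
move=> nS; rewrite size_sphereS -big_filter -[RHS]big_filter; apply: perm_big.
apply: uniq_perm; rewrite ?filter_uniq ?ints_uniq// => k.
rewrite !mem_filter !mem_ints /=; case kn: (k ^+ 2 <= n%:Z) => //=.
have k1 : (`|k| <= S)%N by rewrite -leq_sqr; move: nS kn; clear; lia.
by rewrite k1; move: kn; clear; rewrite -lez_nat; nia.
Qed.

(** Summing the bound for four squares over the fifth coordinate [k] gives
    [sum_f (S^2/f) |B_f|], where [B_f] lists the [k] with [k^2 = n] modulo [f]
    and has at most [8 S f^(-1/4)] elements.  The field [R] serves only to
    evaluate fourth roots. *)
Lemma five_squares_le (R : rcfType) (n S : nat) : (0 < S)%N -> (n <= S ^ 2)%N ->
  (size (sphere predT 5 n) <= 2563 * S ^ 3)%N.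
Proof.
move=> S0 nS.
pose B f := [seq k <- ints S | (f %| `|(n%:Z - k ^+ 2)%R|)%N].
(* The summand 1 accounts for the k with n - k^2 = 0. *)
have step1 : (size (sphere predT 5 n) <=
    \sum_(k <- ints S)
      (1 + 64 * \sum_(1 <= f < S.+1 | f %| `|(n%:Z - k ^+ 2)%R|) S ^ 2 %/ f))%N.
  rewrite (size_sphereS_ints 4 nS).
  rewrite big_mkcond; apply: leq_sum => k _; case: ifP => // kn.
  have [m me] : exists m : nat, n%:Z - k ^+ 2 = m%:Z.
    by exists `|(n%:Z - k ^+ 2)%R|%N; lia.
  rewrite me absz_nat; have [->|m0] := posnP m.
    by rewrite (_ : size _ = 1)//; vm_compute.
  have mS : (m <= S ^ 2)%N by have := sqr_ge0 k; lia.
  apply: leq_trans (four_squares_le m0) _.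
  have := @sigma_le_half m S; rewrite m0 mS => /(_ isT) h.
  apply: leq_trans (leq_mul (leqnn 32) h) _; rewrite mulnA.
  apply: leq_trans (leq_addl 1 _); rewrite leq_mul2l /=.
  by apply: leq_sum => f _; exact: leq_div2r.
have step2 : (size (sphere predT 5 n) <=
    (2 * S).+1 + 64 * \sum_(1 <= f < S.+1) S ^ 2 %/ f * size (B f))%N.
  apply: leq_trans step1 _; rewrite big_split /= sum1_size size_ints leq_add2l.
  rewrite -big_distrr leq_mul2l /=.
  under eq_bigr do rewrite big_mkcond.
  rewrite exchange_big /=; apply: leq_sum => f _.
  rewrite -big_mkcond -big_filter -/(B f) big_const_seq count_predT iter_addn_0.
  by rewrite mulnC.
rewrite -(ler_nat R); move: step2; rewrite -(ler_nat R) => /le_trans; apply.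
rewrite natrD natrM natr_sum.
have step3 : \sum_(1 <= f < S.+1) (S ^ 2 %/ f * size (B f))%:R <=
    8 * S%:R ^+ 3 * 5 :> R.
  apply: le_trans (ler_wpM2l _ (sum_inv_root_le R S)); last first.
    by rewrite mulr_ge0// exprn_ge0.
  rewrite mulr_sumr; apply: ler_sum_nat => f /andP[f0 fS].
  pose q : R := Num.sqrt (Num.sqrt f%:R).
  have q4 : q ^+ 4 = f%:R by rewrite /q (exprM _ 2 2) !sqr_sqrtr ?sqrtr_ge0// ler0n.
  have q0 : 0 < q by rewrite /q !sqrtr_gt0 ltr0n.
  have Bq : (size (B f))%:R * q <= 8 * S%:R.
    rewrite -(@ler_pXn2r _ 4)// ?nnegrE; last 2 first.
    - by rewrite mulr_ge0// ltW.
    - by rewrite mulr_ge0.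
    have /(@size_roots_le f S n) : (0 < f <= S)%N by rewrite f0 -ltnS.
    by rewrite -(ler_nat R) !(natrM, natrX) -q4 -exprMn.
  have Sf : (S ^ 2 %/ f)%:R <= S%:R ^+ 2 / f%:R :> R.
    by rewrite ler_pdivlMr ?ltr0n// -natrX -natrM ler_nat leq_divM.
  rewrite natrM -/q invfM.
  have := ler_pM (ler0n _ _) (mulr_ge0 (ler0n _ _) (ltW q0)) Sf Bq.
  rewrite mulrA -ler_pdivlMr// => /le_trans; apply.
  by rewrite le_eqVlt; apply/orP; left; apply/eqP; ring.
(* The total is at most 3 S^3 + 64 * 40 S^3. *)
have S1 : (1 <= S%:R :> R) by rewrite ler1n.
have S3 : (S%:R : R) <= S%:R ^+ 3.
  exact: ler_eXnr.
rewrite natrM natrX; lra.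
Qed.

(** Each further coordinate takes at most [2S + 1 <= 3S] values. *)
Lemma squares_le (R : rcfType) e (n S : nat) : (0 < S)%N -> (n <= S ^ 2)%N ->
  (size (sphere predT (5 + e) n) <= 2563 * 3 ^ e * S ^ (3 + e))%N.
Proof.
move=> S0; elim: e n => [|e IH] n nS.
  by rewrite !addn0 expn0 muln1; exact: (five_squares_le R).
rewrite addnS (size_sphereS_ints _ nS).
have bnd : (\sum_(k <- ints S | (k ^+ 2 <= n%:Z)%R)
      size (sphere predT (5 + e) (n%:Z - k ^+ 2)) <=
    \sum_(k <- ints S) 2563 * 3 ^ e * S ^ (3 + e))%N.
  rewrite big_mkcond; apply: leq_sum => k _; case: ifP => // kn.
  have [m me] : exists m : nat, n%:Z - k ^+ 2 = m%:Z.
    by exists `|(n%:Z - k ^+ 2)%R|%N; lia.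
  by rewrite me; apply: IH; have := sqr_ge0 k; lia.
apply: leq_trans bnd _; rewrite big_const_seq count_predT size_ints iter_addn_0.
by rewrite addnS !expnS; move: (3 ^ e)%N (S ^ (3 + e))%N => x y; nia.
Qed.

Lemma size_sphere_neg P d n : n < 0 -> size (sphere P d n) = 0%N.
Proof.
move=> n0; case E: (sphere P d n) => [//|s l].
have : s \in sphere P d n by rewrite E mem_head.
by rewrite mem_sphere => /and3P[_ _ /eqP]; have := sumsq_ge0 s; lia.
Qed.

(** * Lower bound for sums of squares *)

(** Here [n = 4m] with [m] odd, and [sigma(m) >= m]. *)
Lemma four_squares_ge n : (n = 4 %[mod 8])%N ->
  (4 * n <= size (sphere predT 4 n))%N.
Proof.
move=> n4; have [m [nm om]] : exists m, n = (4 * m)%N /\ odd m.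
  by exists (n %/ 4)%N; lia.
have m0 : (0 < m)%N by case: (m) om.
have ms : (m <= sigma m)%N.
  rewrite /sigma (bigD1_seq m) ?divisors_uniq ?leq_addr//=.
  by rewrite -dvdn_divisors.
have := jacobi_four_odd_squares om.
have -> : 4 * m%:Z = n%:Z by lia.
move=> J; apply: (@leq_trans (size (sphere oddz 4 n))); first by rewrite J; lia.
apply: (sphere_size_le (phi := id)) => // s.
by rewrite !mem_sphere all_predT => /and3P[-> _ ->].
Qed.

(** Each coordinate beyond the first four runs through [i + 8j], [j < J], for
    its prescribed residue [i] in [a]; the residues are such that the last four
    squares must add up to 4 modulo 8, and [h] bounds that sum from below. *)
Lemma squares_ge_residues (a : seq nat) (h J n : nat) :
    all (fun i => i <= 2)%N a -> (64 * size a * J ^ 2 + h <= n)%N ->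
    (n = \sum_(i <- a) i ^ 2 + 4 %[mod 8])%N ->
  (J ^ size a * (4 * h) <= size (sphere predT (4 + size a) n))%N.
Proof.
elim: a n => [|i a IH] n /=.
  rewrite big_nil !muln0 mul0n mul1n !add0n addn0 => _ hn n4.
  by apply: leq_trans (four_squares_ge n4); rewrite leq_mul2l.
rewrite big_cons => /andP[i2 a2] hn nmod; rewrite addnS size_sphereS.
pose K := [seq (i + 8 * j)%N%:Z | j <- iota 0 J].
have KE k : k \in K -> exists m : nat,
    [/\ n%:Z - k ^+ 2 = m%:Z, (64 * size a * J ^ 2 + h <= m)%N,
        (m = \sum_(i <- a) i ^ 2 + 4 %[mod 8])%N & 0 <= k].
  move=> /mapP[j]; rewrite mem_iota => jJ ->.
  have ij : (i + 8 * j <= 8 * J)%N by lia.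
  have ij2 : ((i + 8 * j) ^ 2 <= 64 * J ^ 2)%N by nia.
  have [q eij] : exists q, ((i + 8 * j) ^ 2 = i ^ 2 + 8 * q)%N.
    by exists (2 * i * j + 8 * j ^ 2)%N; ring.
  exists (n - (i + 8 * j) ^ 2)%N.
  have hn' : (64 * J ^ 2 + (64 * size a * J ^ 2 + h) <= n)%N.
    by apply: leq_trans hn; rewrite mulnS mulnDl addnA.
  have ijn : ((i + 8 * j) ^ 2 <= n)%N.
    by rewrite (leq_trans ij2)// (leq_trans _ hn') ?leq_addr.
  split; [by rewrite expr2 -PoszM mulnn subzn//|by lia| |by lia].
  move: nmod ijn; rewrite eij; clear.
  move: (i ^ 2)%N => i2; move: (\sum_(i <- a) i ^ 2)%N => w; lia.
have -> : (\sum_(k <- ints n | predT k && (k ^+ 2 <= n%:Z)%R)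
      size (sphere predT (4 + size a) (n%:Z - k ^+ 2)) =
    \sum_(k <- [seq k <- ints n | (k ^+ 2 <= n%:Z)%R])
      size (sphere predT (4 + size a) (n%:Z - k ^+ 2)))%N by rewrite big_filter.
apply: (@leq_trans (\sum_(k <- K) J ^ size a * (4 * h))%N).
  by rewrite big_const_seq count_predT iter_addn_0 size_map size_iota expnS -mulnA mulnC.
apply: (@leq_trans
   (\sum_(k <- K) size (sphere predT (4 + size a) (n%:Z - k ^+ 2)))%N).
  rewrite big_seq [leqRHS]big_seq; apply: leq_sum => k /KE[m [-> hm mm _]].
  exact: IH.
have uK : uniq K by rewrite map_inj_uniq ?iota_uniq// => x y; lia.
set L := [seq k <- _ | _].
have KL : {subset K <= L}.
  move=> k /KE[m [km _ _ k0]]; rewrite mem_filter mem_ints; apply/andP; split; first by lia.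
  by rewrite -lez_nat; nia.
have <- : (\sum_(k <- [seq k <- L | k \in K])
    size (sphere predT (4 + size a) (n%:Z - k ^+ 2)) = \sum_(k <- K)
    size (sphere predT (4 + size a) (n%:Z - k ^+ 2)))%N.
  apply: perm_big; apply: uniq_perm; rewrite ?filter_uniq ?ints_uniq// => k.
  by rewrite mem_filter; case kK: (k \in K); rewrite //= KL.
rewrite big_filter big_mkcond; apply: leq_sum => k _; by case: ifP.
Qed.

(** Every residue modulo 8 is a sum of four of the squares 0, 1, 4. *)
Lemma residues_mod8 D r : (4 <= D)%N -> exists a : seq nat,
  [/\ all (fun i => i <= 2)%N a, size a = D & (r = \sum_(i <- a) i ^ 2 + 4 %[mod 8])%N].
Proof.
move=> D4; suff [b [b4 b2 rb]] : exists b : seq nat,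
    [/\ size b = 4, all (fun i => i <= 2)%N b
      & (r = \sum_(i <- b) i ^ 2 + 4 %[mod 8])%N].
  exists (b ++ nseq (D - 4) 0%N).
  rewrite all_cat b2 all_nseq orbT size_cat b4 size_nseq subnKC//; split=> //.
  by rewrite rb big_cat /= big_nseq iter_addn_0 mul0n addn0.
have : (r %% 8 < 8)%N by rewrite ltn_mod.
case: (r %% 8)%N => [|[|[|[|[|[|[|[|?]]]]]]]] // _;
  [exists [:: 1; 1; 1; 1]%N|exists [:: 2; 1; 0; 0]%N|exists [:: 2; 1; 1; 0]%N
  |exists [:: 2; 1; 1; 1]%N|exists [:: 0; 0; 0; 0]%N|exists [:: 1; 0; 0; 0]%N
  |exists [:: 1; 1; 0; 0]%N|exists [:: 1; 1; 1; 0]%N];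
  by rewrite !big_cons big_nil.
Qed.

Lemma squares_ge D J n : (4 <= D)%N -> (128 * D * J ^ 2 <= n)%N ->
  (J ^ D * (2 * n) <= size (sphere predT (4 + D) n))%N.
Proof.
move=> D4 hn; have [a [a2 aD na]] := residues_mod8 n D4.
have := @squares_ge_residues a (n - 64 * D * J ^ 2)%N J n a2.
rewrite aD => h; apply: leq_trans (h _ na); rewrite ?leq_mul2l; last by lia.
by apply/orP; right; lia.
Qed.

(** The upper bound is used at the radius [3M], because
    [2 lambda < 2 (M+1)^2 <= (3M)^2].  For the lower bound [J] is of order
    [sqrt lambda] unless [lambda] is bounded, and in that case one point on the
    sphere in dimension [2d] suffices. *)
Lemma sphere_ratio_le (R : rcfType) d : (5 <= d)%N -> exists C : nat,
  forall (lambda M : nat) (n : int), (0 < lambda)%N ->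
    (M ^ 2 <= lambda < M.+1 ^ 2)%N -> n <= 2 * lambda%:Z ->
    (0 < size (sphere predT (d + d) lambda))%N ->
  (size (sphere predT d n) * M ^ d <= C * size (sphere predT (d + d) lambda))%N.
Proof.
move=> d5; have [e de] : exists e, d = (5 + e)%N by exists (d - 5)%N; lia.
pose A := (2563 * 3 ^ e * 3 ^ (3 + e))%N; pose D := (6 + 2 * e)%N.
exists (A * ((512 * D) ^ (3 + e) + (128 * D) ^ (8 + 2 * e)))%N.
move=> lam M n lam0 /andP[Ml lM] n2 N0; set N := size _ in N0 *.
have M0 : (0 < M)%N by case: M lM {Ml} => //; lia.
have up : (size (sphere predT d n) <= A * M ^ (3 + e))%N.
  have [n0|n0] := ltP n 0; first by rewrite size_sphere_neg.
  have [m me] : exists m : nat, n = m%:Z by exists `|n|%N; lia.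
  rewrite me de; apply: leq_trans (@squares_le R e m (3 * M) _ _) _; rewrite ?muln_gt0//.
    by move: Ml lM n2; rewrite me; clear -M0; nia.
  by rewrite expnMn mulnA.
have up2 : (size (sphere predT d n) * M ^ d <= A * M ^ (8 + 2 * e))%N.
  apply: leq_trans (leq_mul up (leqnn _)) _.
  by rewrite -mulnA -expnD leq_mul2l de leq_pexp2l ?orbT//; lia.
apply: leq_trans up2 _; rewrite -mulnA leq_mul2l; apply/orP; right.
have D0 : (0 < 128 * D)%N by rewrite /D; lia.
have [J /andP[Jl lJ]] := floor_sqrt (lam %/ (128 * D)).
have Jl' : (128 * D * J ^ 2 <= lam)%N by rewrite mulnC -leq_divRL.
have lJ' : (lam < 128 * D * J.+1 ^ 2)%N by rewrite mulnC -ltn_divLR.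
rewrite mulnDl; have [J0|J0] := posnP J.
  apply: leq_trans (leq_addl _ _); apply: leq_trans (leq_pmulr _ N0).
  rewrite leq_exp2r ?addSn//; move: Ml lJ'; rewrite J0; clear; nia.
apply: leq_trans (leq_addr _ _).
have : (J ^ D * (2 * lam) <= N)%N.
  rewrite /N de; have -> : (5 + e + (5 + e) = 4 + D)%N by rewrite /D; lia.
  by apply: squares_ge => //; rewrite /D; lia.
move=> low; apply: leq_trans (leq_mul (leqnn _) low).
(* M^2 <= lambda < 128 D (J + 1)^2 <= 512 D J^2, and D = 2 (d - 2). *)
have -> : D = (2 * (3 + e))%N by rewrite /D; lia.
have -> : (8 + 2 * e = 2 * (3 + e) + 2)%N by lia.
rewrite expnD [(M ^ _)%N]expnM [(J ^ _)%N]expnM mulnA -expnMn.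
apply: leq_mul; last by lia.
rewrite leq_exp2r ?addSn//.
have -> : (2 * (3 + e) = D)%N by rewrite /D; lia.
by move: Ml lJ' J0; clear; move: (D) => E; nia.
Qed.

(** * The bilinear form of the average on a box *)

Definition coords d (u : 'rV[int]_d) : seq int := [seq u 0 i | i <- enum 'I_d].

Lemma coords_inj d : injective (@coords d).
Proof.
move=> u v /eq_in_map uv; apply/rowP => i.
by have := uv i; rewrite mem_enum => ->.
Qed.

Lemma mem_coords d (u : 'rV[int]_d) n :
  (coords u \in sphere predT d n) = (sqnorm u == n).
Proof.
rewrite mem_sphere all_predT size_map size_enum_ord eqxx /=.
by rewrite /sumsq big_map big_enum.
Qed.

Lemma bisphereE d lambda (uv : 'rV[int]_d * 'rV[int]_d) :
  (uv \in fset_set (@bisphere d lambda)) =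
  (sqnorm uv.1 + sqnorm uv.2 == lambda%:Z).
Proof.
rewrite in_fset_set; last exact: finite_bisphere.
by apply/idP/eqP; rewrite inE.
Qed.

Lemma bisphere_card_ge d (lambda : nat) :
  (size (sphere predT (d + d) lambda) <= bisphere_card d lambda)%N.
Proof.
pose phi (s : seq int) : 'rV[int]_d * 'rV[int]_d :=
  (\row_i s`_i, \row_i s`_(d + i)).
rewrite /bisphere_card -(size_map phi); apply: uniq_leq_size.
  rewrite map_inj_in_uniq ?sphere_uniq// => s t.
  rewrite !mem_sphere => /and3P[/eqP sd _ _] /and3P[/eqP td _ _] [/rowP e1 /rowP e2].
  apply: (@eq_from_nth _ 0); first by rewrite sd td.
  move=> i; rewrite sd => id; have [idd|ddi] := ltnP i d.
    by have := e1 (Ordinal idd); rewrite !mxE.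
  have h : (i - d < d)%N by rewrite ltn_subLR.
  by have := e2 (Ordinal h); rewrite !mxE /= subnKC.
move=> uv /mapP[s + ->]; rewrite mem_sphere => /and3P[/eqP sd _ /eqP es].
rewrite bisphereE -es /phi /sqnorm /sumsq (big_nth 0) sd big_mkord big_split_ord /=.
by apply/eqP; congr (_ + _); apply: eq_bigr => i _; rewrite mxE.
Qed.

Lemma bisphere_card_eq0 d (lambda : nat) :
  size (sphere predT (d + d) lambda) = 0%N -> bisphere_card d lambda = 0%N.
Proof.
move=> /size0nil s0; apply/eqP; rewrite cardfs_eq0; apply/eqP/fsetP => -[u v].
rewrite bisphereE in_fset0; apply/negbTE/negP => /= /eqP e.
suff : coords (row_mx u v) \in sphere predT (d + d) lambda by rewrite s0.
rewrite mem_coords /sqnorm big_split_ord /= -e; apply/eqP.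
by congr (_ + _); apply: eq_bigr => i _; rewrite ?row_mxEl ?row_mxEr.
Qed.

(** The cube of the points of sup norm at most [k], listed through a finite type
    of matrices, which gives its cardinal. *)
Definition box d k : seq 'rV[int]_d :=
  [seq map_mx (fun j : 'I_(2 * k).+1 => j%:Z - k%:Z) w
     | w <- enum {: 'rV['I_(2 * k).+1]_d}].

Lemma mem_box d k (u : 'rV[int]_d) :
  (u \in box d k) = [forall i, (`|u 0%R i| <= k)%N].
Proof.
apply/mapP/forallP => [[w _ ->] i|uk].
  by rewrite mxE /=; case: (w 0 i) => j /= jk; lia.
exists (\row_i inord `|(u 0 i + k%:Z)%R|%N); first by rewrite mem_enum.
apply/rowP => i; have := uk i; rewrite !mxE; move: (u 0 i) => x xk.
by rewrite inordK; lia.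
Qed.

Lemma box_uniq d k : uniq (box d k).
Proof.
rewrite map_inj_uniq ?enum_uniq// => v w /rowP vw.
by apply/rowP => i; apply: val_inj; have := vw i; rewrite !mxE /=; lia.
Qed.

Lemma size_box d k : size (box d k) = ((2 * k).+1 ^ d)%N.
Proof. by rewrite size_map -cardE card_mx card_ord mul1n. Qed.

Lemma sqnorm_le_box d k (u : 'rV[int]_d) :
  sqnorm u < (k.+1 ^ 2)%N%:Z -> u \in box d k.
Proof.
move=> uk; rewrite mem_box; apply/forallP => i.
have := le_lt_trans (sqnorm_coord u i) uk.
by move: (u 0 i) => x; rewrite -ltnS -ltn_sqr -ltz_nat; lia.
Qed.

Lemma box_sub d k (r u : 'rV[int]_d) :
  r \in box d k -> u \in box d k -> r - u \in box d (2 * k).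
Proof.
rewrite !mem_box => /forallP rk /forallP uk; apply/forallP => i.
have := rk i; have := uk i; rewrite !mxE.
by move: (r 0 i) (u 0 i) => x y; lia.
Qed.

Lemma sqnorm_parallelogram d (r y z : 'rV[int]_d) :
  sqnorm (r + r - y - z) =
  2 * (sqnorm (r - y) + sqnorm (r - z)) - sqnorm (y - z).
Proof.
rewrite /sqnorm -big_split mulr_sumr -sumrB; apply: eq_bigr => i _ /=.
by rewrite !mxE; ring.
Qed.

(** By the parallelogram law [2r - y - z] lies on a sphere that depends only on
    [y] and [z]. *)
Lemma size_fiber_le d (Q : seq 'rV[int]_d) (y z : 'rV[int]_d) (n : int) :
    uniq Q ->
  (size [seq r <- Q | (sqnorm (r - y) + sqnorm (r - z) == n)%R] <=
   size (sphere predT d (2 * n - sqnorm (y - z))))%N.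
Proof.
move=> uQ; rewrite -(size_map (fun r => coords (r + r - y - z))).
apply: uniq_leq_size.
  rewrite map_inj_uniq ?filter_uniq// => r t /coords_inj/rowP rt.
  apply/rowP => i; have := rt i; rewrite !mxE.
  by move: (r 0 i) (t 0 i) (y 0 i) (z 0 i) => a b c e; lia.
move=> s /mapP[r + ->]; rewrite mem_filter => /andP[/eqP rn _].
by rewrite mem_coords sqnorm_parallelogram rn.
Qed.

(** For fixed [r] the points [(u, v)] of the bisphere correspond to the pairs
    [(y, z) = (r - u, r - v)]; exchanging the sums leaves, for each [(y, z)],
    the number of admissible [r], which [size_fiber_le] bounds. *)
Lemma sum_bisphere_le (R : realDomainType) d (lambda M K : nat)
    (a b : 'rV[int]_d -> R) :
    (lambda < M.+1 ^ 2)%N -> (forall y, 0 <= a y) -> (forall y, 0 <= b y) ->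
    (forall n : int, n <= 2 * lambda%:Z -> (size (sphere predT d n) <= K)%N) ->
  \sum_(r <- box d M) \sum_(uv <- fset_set (@bisphere d lambda))
     a (r - uv.1) * b (r - uv.2) <=
  K%:R * (\sum_(y <- box d (2 * M)) a y) * (\sum_(z <- box d (2 * M)) b z).
Proof.
move=> lM a0 b0 hK; set B := fset_set _; set Y := box d (2 * M).
pose P r (yz : 'rV[int]_d * 'rV[int]_d) :=
  sqnorm (r - yz.1) + sqnorm (r - yz.2) == lambda%:Z.
pose YY := [seq (y, z) | y <- Y, z <- Y].
have uYY : uniq YY.
  by apply: allpairs_uniq; rewrite ?box_uniq// => -[? ?] [? ?] _ _ [-> ->].
have inner r : r \in box d M ->
    \sum_(uv <- B) a (r - uv.1) * b (r - uv.2) =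
    \sum_(yz <- YY | P r yz) a yz.1 * b yz.2.
  move=> rM.
  apply: (@sum_seq_bij _ _ R B YY predT (P r)
    (fun uv => (r - uv.1, r - uv.2)) (fun yz => (r - yz.1, r - yz.2))
    (fun yz => a yz.1 * b yz.2)) => //.
  - move=> [u v]; rewrite bisphereE /= => /eqP uv _.
    have uM : u \in box d M.
      by apply: sqnorm_le_box; have := sqnorm_ge0 v; lia.
    have vM : v \in box d M.
      by apply: sqnorm_le_box; have := sqnorm_ge0 u; lia.
    split; last by rewrite !subKr.
      by apply/allpairsP; exists (r - u, r - v); rewrite !box_sub.
    by rewrite /P /= !subKr uv.
  - move=> [y z] _ /= h; split=> //; last by rewrite !subKr.
    by rewrite bisphereE.
rewrite big_seq (eq_bigr _ inner) -big_seq.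
under eq_bigr do rewrite big_mkcond.
rewrite exchange_big /=.
apply: (@le_trans _ _ (\sum_(yz <- YY) K%:R * (a yz.1 * b yz.2))).
  apply: ler_sum => -[y z] _; rewrite -big_mkcond /= -big_filter big_const_seq.
  rewrite count_predT iter_addr_0 -[leLHS]mulr_natl ler_wpM2r ?mulr_ge0// ler_nat.
  apply: leq_trans (size_fiber_le _ _ _ (box_uniq d M)) (hK _ _).
  by rewrite lerBlDr lerDl sqnorm_ge0.
rewrite big_allpairs_dep /= -mulrA mulr_suml mulr_sumr; apply: ler_sum => y _.
by rewrite mulr_sumr mulr_sumr.
Qed.

(** * Power means *)

(** Young's inequality between [a i] and the power [p - 1] of the mean [m] is
    the tangent line inequality for the [p]-th power at [m]; summing it gives
    Jensen's inequality. *)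
Lemma power_mean (R : realType) (I : Type) (r : seq I) (a : I -> R) (p : R) :
    1 <= p -> (forall i, 0 <= a i) ->
  (\sum_(i <- r) a i) `^ p <= (size r)%:R `^ (p - 1) * \sum_(i <- r) a i `^ p.
Proof.
move=> p1 a0; have p0 : 0 < p by lra.
have [r0|r0] := posnP (size r).
  by rewrite (size0nil r0) !big_nil powR0 ?gt_eqF// mulr0.
set n : R := (size r)%:R; have n0 : 0 < n by rewrite ltr0n.
pose m := (\sum_(i <- r) a i) / n.
have nm : \sum_(i <- r) a i = n * m by rewrite /m mulrC divfK// gt_eqF.
have m0 : 0 <= m by rewrite divr_ge0 ?sumr_ge0// ltW.
have sum_cst (c : R) : \sum_(i <- r) c = n * c.
  by rewrite big_const_seq count_predT iter_addr_0 mulr_natl.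
suff h : n * m `^ p <= \sum_(i <- r) a i `^ p.
  rewrite nm powRM ?(ltW n0)// -[n `^ p](mulr_powRB1 (ltW n0) p0).
  by rewrite [n * _]mulrC -mulrA ler_wpM2l// powR_ge0.
have [->|pn1] := eqVneq p 1.
  by rewrite powRr1// -nm; apply: ler_sum => i _; rewrite powRr1.
have p1' : 0 < p - 1 by rewrite subr_gt0 lt_neqAle eq_sym pn1.
have young i : a i * m `^ (p - 1) <= a i `^ p / p + m `^ p * (1 - p^-1).
  have := @conjugate_powR R (a i) (m `^ (p - 1)) p (p / (p - 1)) (a0 i)
    (powR_ge0 _ _) p0 (divr_gt0 p0 p1').
  have -> : (p / (p - 1))^-1 = 1 - p^-1 by field; rewrite !gt_eqF.
  have -> : (m `^ (p - 1)) `^ (p / (p - 1)) = m `^ p.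
    by rewrite -powRrM; congr (_ `^ _); field; rewrite gt_eqF.
  by apply; ring.
have : \sum_(i <- r) a i * m `^ (p - 1) <=
    \sum_(i <- r) (a i `^ p / p + m `^ p * (1 - p^-1)).
  by apply: ler_sum => j _; exact: young.
rewrite -mulr_suml nm -mulrA mulr_powRB1// big_split /= -mulr_suml sum_cst.
move: (m `^ p) (\sum_(i <- r) a i `^ p) => x y h.
have : n * x / p <= y / p by lra.
by rewrite ler_pM2r// invr_gt0.
Qed.

(** [power_mean] for the exponent [1/s] and the numbers [a i `^ s]. *)
Lemma power_mean_concave (R : realType) (I : Type) (r : seq I) (a : I -> R) (s : R) :
    0 < s -> s <= 1 -> (forall i, 0 <= a i) ->
  \sum_(i <- r) a i `^ s <= (size r)%:R `^ (1 - s) * (\sum_(i <- r) a i) `^ s.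
Proof.
move=> s0 s1 a0; have sV : 1 <= s^-1 by rewrite invf_ge1.
have := power_mean r sV (fun i => powR_ge0 (a i) s).
under [X in _ <= _ * X]eq_bigr do rewrite -powRrM divff ?gt_eqF// powRr1//.
set S := \sum_(i <- r) a i `^ s => h.
have S0 : 0 <= S by apply: sumr_ge0 => i _; exact: powR_ge0.
have -> : S = (S `^ s^-1) `^ s by rewrite -powRrM mulVf ?gt_eqF// powRr1.
have A0 : 0 <= \sum_(i <- r) a i by exact: sumr_ge0.
apply: le_trans (ge0_ler_powR (ltW s0) _ _ h) _; rewrite ?nnegrE ?powR_ge0//.
  by rewrite mulr_ge0 ?powR_ge0.
by rewrite powRM ?powR_ge0// -powRrM mulrBl mulVf ?gt_eqF// mul1r.
Qed.

Lemma power_mean_root (R : realType) (I : Type) (r : seq I) (a : I -> R) (p : R) :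
    1 <= p -> (forall i, 0 <= a i) ->
  \sum_(i <- r) a i <=
    (size r)%:R `^ (1 - p^-1) * (\sum_(i <- r) a i `^ p) `^ p^-1.
Proof.
move=> p1 a0; have p0 : 0 < p by lra.
have := @power_mean_concave R I r (fun i => a i `^ p) p^-1.
under [X in _ -> _ -> _ -> X <= _]eq_bigr do rewrite -powRrM divff ?gt_eqF// powRr1//.
by apply=> [||i]; rewrite ?invr_gt0 ?invf_le1 ?powR_ge0.
Qed.

(** The product [(F/A)(G/B)] is at most 1 and [t >= 1/2], so its power [t] is at
    most its square root, hence at most the arithmetic mean.  This linearises
    the product so that it can be summed over translates.  When [A] or [B]
    vanishes so does the left side. *)
Lemma powR_prod_le (R : realType) (A B F G t : R) :
    0 <= F <= A -> 0 <= G <= B -> 2^-1 <= t ->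
  (F * G) `^ t <= (A * B) `^ t * ((F / A + G / B) / 2).
Proof.
move=> /andP[F0 FA] /andP[G0 GB] t2.
have A0 := le_trans F0 FA; have B0 := le_trans G0 GB.
have t0 : t != 0 by rewrite gt_eqF//; lra.
have rhs0 : 0 <= (A * B) `^ t * ((F / A + G / B) / 2).
  by rewrite mulr_ge0 ?powR_ge0// divr_ge0// addr_ge0// divr_ge0.
have [FG|FG] := eqVneq (F * G) 0; first by rewrite FG powR0.
have [Fn Gn] : F != 0 /\ G != 0 by apply/andP; rewrite -negb_or -mulf_eq0.
have Ap : 0 < A by apply: lt_le_trans FA; rewrite lt_neqAle eq_sym Fn.
have Bp : 0 < B by apply: lt_le_trans GB; rewrite lt_neqAle eq_sym Gn.
have -> : F * G = (A * B) * ((F / A) * (G / B)).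
  by field; rewrite !gt_eqF.
set x := F / A; set y := G / B.
have x0 : 0 < x by rewrite divr_gt0// lt_neqAle eq_sym Fn.
have y0 : 0 < y by rewrite divr_gt0// lt_neqAle eq_sym Gn.
have x1 : x <= 1 by rewrite ler_pdivrMr// mul1r.
have y1 : y <= 1 by rewrite ler_pdivrMr// mul1r.
have xy0 : 0 <= x * y by rewrite mulr_ge0// ltW.
rewrite (powRM _ (mulr_ge0 A0 B0) xy0) ler_wpM2l ?powR_ge0//.
apply: (@le_trans _ _ ((x * y) `^ 2^-1)).
  by apply: ger_powR => //; rewrite mulr_gt0//= mulr_ile1// ltW.
rewrite powR12_sqrt//.
have a0 : 0 <= (x + y) / 2 by rewrite divr_ge0// addr_ge0// ltW.
rewrite -[leRHS]ger0_norm// -sqrtr_sqr ler_sqrt ?sqr_ge0// -subr_ge0.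
have -> : ((x + y) / 2) ^+ 2 - x * y = ((x - y) / 2) ^+ 2 by field.
exact: sqr_ge0.
Qed.

(** * The average on one box *)

Notation modulus := Normc.normc.

Lemma modulus_ge0 (R : rcfType) (z : R[i]) : 0 <= modulus z.
Proof. by case: z => a b; exact: sqrtr_ge0. Qed.

Lemma modulus_sum_le (R : rcfType) (I : Type) (r : seq I) (F : I -> R[i]) :
  modulus (\sum_(i <- r) F i) <= \sum_(i <- r) modulus (F i).
Proof.
elim: r => [|i r IH]; first by rewrite !big_nil Normc.normc0.
rewrite !big_cons; apply: le_trans (le_normcD _ _) _.
by rewrite lerD2l.
Qed.

Lemma modulus_nat (R : rcfType) n : modulus (n%:R : R[i]) = n%:R.
Proof. by rewrite -[n%:R]/(1 *+ n) (normcMn (1 : R[i])) Normc.normc1. Qed.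

Lemma bilinear_average_modulus_le (R : realType) d lambda
    (f g : 'rV[int]_d -> R[i]) x :
  modulus (bilinear_average lambda f g x) <=
  (bisphere_card d lambda)%:R^-1 *
  \sum_(uv <- fset_set (@bisphere d lambda))
    modulus (f (x - uv.1)) * modulus (g (x - uv.2)).
Proof.
rewrite /bilinear_average Normc.normcM Normc.normcV modulus_nat ler_wpM2l ?invr_ge0//.
rewrite fsbig_finite/=; last exact: finite_bisphere.
apply: le_trans (modulus_sum_le _ _) _.
by apply: ler_sum => uv _; rewrite Normc.normcM.
Qed.

(** The counting bounds make the kernel of the bilinear form at most
    [C / M^d].  If the bisphere is empty the average vanishes. *)
Lemma average_box_le (R : realType) d : (5 <= d)%N -> exists2 C : R, 0 < C &
  forall (lambda M : nat) (f g : 'rV[int]_d -> R[i]) c, (0 < lambda)%N ->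
    (M ^ 2 <= lambda < M.+1 ^ 2)%N ->
  \sum_(r <- box d M) modulus (bilinear_average lambda f g (c + r)) <=
  C / M%:R ^+ d * (\sum_(y <- box d (2 * M)) modulus (f (c + y))) *
                  (\sum_(z <- box d (2 * M)) modulus (g (c + z))).
Proof.
move=> d5; have [C hC] := sphere_ratio_le R d5.
exists C.+1%:R; first by rewrite ltr0n.
move=> lam M f g c lam0 /andP[Ml lM]; set N := bisphere_card d lam.
set SF := \sum_(y <- _) modulus (f _); set SG := \sum_(z <- _) modulus (g _).
have SF0 : 0 <= SF by apply: sumr_ge0 => y _; exact: modulus_ge0.
have SG0 : 0 <= SG by apply: sumr_ge0 => y _; exact: modulus_ge0.
have M0 : (0 < M)%N by case: (M) lM => //; lia.
have Md0 : (0 < M ^ d)%N by rewrite expn_gt0 M0.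
have [N0|N0] := posnP N.
  rewrite [leLHS]big1 ?mulr_ge0 ?invr_ge0 ?exprn_ge0// => r _.
  by rewrite /bilinear_average -/N N0 invr0 mul0r Normc.normc0.
have S0 : (0 < size (sphere predT (d + d) lam))%N.
  rewrite lt0n; apply: contraL N0 => /eqP/bisphere_card_eq0.
  by rewrite -/N => ->.
(* The largest count on a sphere in dimension d that the comparison allows. *)
pose K := (C * size (sphere predT (d + d) lam) %/ M ^ d)%N.
have hK (n : int) : n <= 2 * lam%:Z -> (size (sphere predT d n) <= K)%N.
  by move=> n2; rewrite /K leq_divRL//; apply: hC; rewrite ?Ml.
have KN : (K * M ^ d <= C * N)%N.
  by apply: leq_trans (leq_divM _ _) _; rewrite leq_mul2l bisphere_card_ge orbT.
have := @sum_bisphere_le R d lam M K (fun y => modulus (f (c + y)))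
  (fun y => modulus (g (c + y))) lM (fun y => modulus_ge0 _)
  (fun y => modulus_ge0 _) hK.
rewrite -/SF -/SG => h.
apply: (@le_trans _ _ (N%:R^-1 * (K%:R * SF * SG))).
  apply: le_trans (ler_wpM2l _ h); rewrite ?invr_ge0// mulr_sumr.
  apply: ler_sum => r _; apply: le_trans (bilinear_average_modulus_le _ _ _ _) _.
  by under eq_bigr do rewrite -!addrA.
rewrite !mulrA ler_wpM2r// ler_wpM2r// ler_pdivlMr ?exprn_gt0 ?ltr0n//.
rewrite -mulrA ler_pdivrMl ?ltr0n// -natrX -!natrM ler_nat.
by apply: leq_trans KN _; rewrite mulnC leq_mul2l leqnSn orbT.
Qed.

(** The left side decreases in [Q] and increases in [Y], so it is at most of
    order [M^(d - 2ds/p)].  As [s >= p/2] this exponent is nonpositive, and the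
    lower bound [M^2 > lambda / 4] turns it into the power of [lambda] on the
    right.  Once everything is written as an exponential the claim is linear in
    the exponents. *)
Lemma scale_bound (R : realType) (d : nat) (C p s : R) :
    0 < C -> 1 < p -> 0 < s -> p / 2 <= s -> exists2 C' : R, 0 < C' &
  forall (lambda M : nat) (Q Y : R), (0 < lambda)%N -> (0 < M)%N ->
    (lambda < M.+1 ^ 2)%N -> M%:R ^+ d <= Q -> 0 <= Y <= (5 * M%:R) ^+ d ->
  Q `^ (1 - s) * (C / M%:R ^+ d * Y `^ (2 - 2 / p)) `^ s * Y / Q <=
  (C' * lambda%:R `^ (d%:R / (2 * s) - d%:R / p)) `^ s.
Proof.
move=> C0 p1 s0 ps; have p0 : 0 < p by lra.
pose t := 2 - 2 / p; pose e := 2 * s / p - 1.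
have t0 : 0 <= t by rewrite subr_ge0 ler_pdivrMr//; lra.
have e0 : 0 <= e by rewrite subr_ge0 ler_pdivlMr//; lra.
(* The logarithm of C'^s, collecting the powers of C, 5 and 4 that arise below. *)
pose u := ln C * s + d%:R * ln 5 * (t * s + 1) + d%:R / 2 * ln 4 * e.
exists (expR (u / s)); first exact: expR_gt0.
move=> lam M Q Y lam0 M0 lM MQ /andP[Y0 YM].
set P : R := M%:R ^+ d in MQ *; have P0 : 0 < P by rewrite exprn_gt0 ?ltr0n.
have Q0 : 0 < Q := lt_le_trans P0 MQ.
have YP : Y <= 5 ^+ d * P by rewrite -exprMn.
have QE : Q `^ (1 - s) / Q = (Q `^ s)^-1.
  rewrite (@powRB _ Q 1 s) ?(gt_eqF Q0) ?implybT// powRr1 ?(ltW Q0)//.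
  by rewrite mulrAC divff ?(gt_eqF Q0)// mul1r.
have step1 : Q `^ (1 - s) * (C / P * Y `^ t) `^ s * Y / Q <=
    (P `^ s)^-1 * (C / P * (5 ^+ d * P) `^ t) `^ s * (5 ^+ d * P).
  have -> : Q `^ (1 - s) * (C / P * Y `^ t) `^ s * Y / Q =
     (Q `^ s)^-1 * (C / P * Y `^ t) `^ s * Y.
    rewrite -QE; move: (Q `^ (1 - s)) ((C / P * Y `^ t) `^ s) Q^-1 => a b q.
    by clear; ring.
  have CP : 0 <= C / P by rewrite divr_ge0 ?ltW.
  have Qs0 : 0 <= (Q `^ s)^-1 by rewrite invr_ge0 powR_ge0.
  apply: (ler_pM (mulr_ge0 Qs0 (powR_ge0 _ _)) Y0 _ YP).
  apply: (ler_pM Qs0 (powR_ge0 _ _)).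
    rewrite lef_pV2 ?posrE ?powR_gt0//.
    by apply: ge0_ler_powR; rewrite ?nnegrE ?(ltW s0) ?(ltW P0) ?(ltW Q0).
  apply: ge0_ler_powR; rewrite ?nnegrE; [exact: ltW| | |].
  - by rewrite mulr_ge0 ?powR_ge0.
  - by rewrite mulr_ge0 ?powR_ge0.
  rewrite ler_wpM2l//; apply: ge0_ler_powR; rewrite ?nnegrE//.
  by rewrite mulr_ge0 ?exprn_ge0// ltW.
apply: le_trans step1 _.
have MR0 : 0 < M%:R :> R by rewrite ltr0n.
have L0 : 0 < lam%:R :> R by rewrite ltr0n.
have lnM : ln lam%:R <= ln 4 + 2 * ln (M%:R : R).
  have -> : 2 * ln (M%:R : R) = ln (M%:R ^+ 2) by rewrite lnXn// mulr_natl.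
  rewrite -lnM ?posrE ?exprn_gt0// ler_ln ?posrE ?mulr_gt0 ?exprn_gt0//.
  by rewrite -natrX -natrM ler_nat; move: lM M0; clear; nia.
move: lnM; rewrite /P -[M%:R]lnK ?posrE// -[lam%:R]lnK ?posrE// !expRK.
rewrite -{1}[C]lnK ?posrE// -[5]lnK ?posrE//.
move: (ln C) (ln M%:R) (ln lam%:R) (ln 4) (ln 5) @u => c m l l4 l5 u lm.
rewrite -!expRM_natl -!expRD -!expRM -!expRN -!expRD -!expRM -!expRD ler_expR.
rewrite -subr_ge0.
have -> : (u / s + l * (d%:R / (2 * s) - d%:R / p)) * s -
  (- (d%:R * m * s) + (c - d%:R * m + (d%:R * l5 + d%:R * m) * t) * s
     + (d%:R * l5 + d%:R * m)) = d%:R / 2 * e * (l4 + 2 * m - l).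
  by rewrite /u /e /t; field; rewrite !gt_eqF.
by rewrite !mulr_ge0// ?invr_ge0// subr_ge0.
Qed.

(** * Sums over all translates of a box *)

Lemma esum_mul_le (R : realType) (T : choiceType) (k : R) (h : T -> \bar R) :
    0 <= k -> (forall x, (0 <= h x)%E) ->
  (\esum_(x in [set: T]) (k%:E * h x) <= k%:E * \esum_(x in [set: T]) h x)%E.
Proof.
move=> k0 h0; apply: ge_ereal_sup => _ [X [finX _] <-].
rewrite -ge0_mule_fsumr//; apply: lee_wpmul2l; first by rewrite lee_fin.
by apply: esum_ge; exists X.
Qed.

Lemma sum_le_esum (R : realType) (T : choiceType) (Y : seq T) (h : T -> \bar R) :
    uniq Y -> (forall x, (0 <= h x)%E) ->
  (\sum_(y <- Y) h y <= \esum_(x in [set: T]) h x)%E.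
Proof.
by move=> uY h0; rewrite fsbig_seq//; apply: esum_ge; exists [set` Y]%classic.
Qed.

Lemma esum_shift (R : realType) d (h : 'rV[int]_d -> \bar R) (y : 'rV[int]_d) :
  (\esum_(x in [set: 'rV[int]_d]) h (x + y)%R =
   \esum_(x in [set: 'rV[int]_d]) h x)%E.
Proof.
rewrite [RHS](reindex_esum [set: 'rV[int]_d] [set: 'rV[int]_d] (fun x => x + y)%R)//.
rewrite setTT_bijective; exists (fun x => x - y)%R => x; first by rewrite addrK.
by rewrite subrK.
Qed.

(** Exchanging the sums leaves, for each [y], a translate of the full sum. *)
Lemma esum_translates (R : realType) d (Y : seq 'rV[int]_d)
    (h : 'rV[int]_d -> \bar R) :
    (forall x, (0 <= h x)%E) ->
  (\esum_(c in [set: 'rV[int]_d]) \sum_(y <- Y) h (c + y)%R =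
   (size Y)%:R%:E * \esum_(x in [set: 'rV[int]_d]) h x)%E.
Proof.
move=> h0; rewrite esum_sum; last by move=> *; exact: h0.
under eq_bigr do rewrite esum_shift.
by rewrite big_const_seq count_predT mule_natl; exact: iter_addr_0.
Qed.

Lemma lsnorm_fin (R : realType) d (p : R) (f : 'rV[int]_d -> R[i]) :
    0 < p -> in_ls p f -> exists A : R,
  [/\ 0 <= A, A%:E = \esum_(x in [set: 'rV[int]_d]) (modulus (f x) `^ p)%:E
    & lsnorm p f = (A `^ p^-1)%:E].
Proof.
move=> p0 fp; set S := \esum_(x in _) _.
have S0 : (0 <= S)%E by apply: esum_ge0 => x _; rewrite lee_fin powR_ge0.
have Sfin : (S < +oo)%E.
  by apply: lty_poweRy fp; rewrite invr_neq0// gt_eqF.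
have SE : (fine S)%:E = S by rewrite fineK// ge0_fin_numE.
exists (fine S); split=> //; first by rewrite fine_ge0.
by rewrite /lsnorm -/S -SE poweR_EFin.
Qed.

Theorem corollary2 (R : realType) (d : nat) (p s : R)
    (hd : (5 <= d)%N)
    (hp1 : (d%:R + 1) / (d%:R - 1) < p) (hp2 : p < 2)
    (hs1 : p / 2 <= s) (hs2 : s <= 1) :
  exists C : R, 0 < C /\
    forall (lambda : nat) (f g : 'rV[int]_d -> R[i]),
      (0 < lambda)%N -> in_ls p f -> in_ls p g ->
      (lsnorm s (bilinear_average lambda f g) <=
         (C * lambda%:R `^ (d%:R / (2 * s) - d%:R / p))%:E
           * lsnorm p f * lsnorm p g)%E.
Proof.
have p1 : 1 < p.
  have d1 : 1 < d%:R :> R by rewrite ltr1n; lia.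
  by apply: lt_trans hp1; rewrite ltr_pdivlMr; lra.
have p0 : 0 < p by lra.
have s0 : 0 < s by lra.
have [C C0 hC] := average_box_le R hd.
have [C' C'0 hC'] := scale_bound d C0 p1 s0 hs1.
exists C'; split=> // lam f g lam0 fp gp.
have [A [A0 AE ->]] := lsnorm_fin p0 fp.
have [B [B0 BE ->]] := lsnorm_fin p0 gp.
have [M /andP[Ml lM]] := floor_sqrt lam.
have M0 : (0 < M)%N by move: lM lam0; clear; case: M => //; lia.
have d0 : (0 < d)%N by move: hd; clear; lia.
have M2 : (M <= (2 * M).+1)%N by clear; lia.
have M5 : ((2 * (2 * M)).+1 <= 5 * M)%N by move: M0; clear; lia.
pose Q := box d M; pose Y := box d (2 * M).
pose q : R := (size Q)%:R; pose y : R := (size Y)%:R.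
have MR0 : 0 < M%:R :> R by rewrite ltr0n.
have qM : M%:R ^+ d <= q.
  by rewrite -natrX ler_nat size_box leq_exp2r.
have q0 : 0 < q by apply: lt_le_trans qM; rewrite exprn_gt0.
have y0 : 0 <= y by [].
have yM : y <= (5 * M%:R) ^+ d.
  by rewrite -natrM -natrX ler_nat size_box leq_exp2r.
pose T := bilinear_average lam f g.
pose phi x : R := modulus (f x) `^ p; pose psi x : R := modulus (g x) `^ p.
pose tau x : R := modulus (T x) `^ s.
pose X := C / M%:R ^+ d * y `^ (2 - 2 / p).
have X0 : 0 <= X by rewrite mulr_ge0 ?powR_ge0// divr_ge0 ?exprn_ge0 ?ltW.
(* W (F/A + G/B) / 2 will bound the sum of tau over the box centred at c. *)
pose W := q `^ (1 - s) * X `^ s * (A * B) `^ (s / p).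
have W0 : 0 <= W by rewrite !mulr_ge0 ?powR_ge0.
have phi0 x : (0 <= (phi x)%:E)%E by rewrite lee_fin powR_ge0.
have psi0 x : (0 <= (psi x)%:E)%E by rewrite lee_fin powR_ge0.
have tau0 x : (0 <= (tau x)%:E)%E by rewrite lee_fin powR_ge0.
have sumY (h : 'rV[int]_d -> R) D c : (forall x, (0 <= (h x)%:E)%E) ->
    D%:E = \esum_(x in [set: 'rV[int]_d]) (h x)%:E ->
    0 <= \sum_(z <- Y) h (c + z) <= D.
  move=> h0 DE; rewrite sumr_ge0/=; last by move=> z _; rewrite -lee_fin.
  rewrite -lee_fin DE -sumEFin -(esum_shift (fun x => (h x)%:E) c).
  under eq_esum do rewrite addrC.
  by apply: (sum_le_esum (h := fun z => (h (c + z))%:E)); rewrite ?box_uniq.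
have point c : \sum_(r <- Q) tau (c + r) <=
    W / 2 / A * \sum_(z <- Y) phi (c + z) + W / 2 / B * \sum_(z <- Y) psi (c + z).
  have := power_mean_concave Q s0 hs2 (fun r => modulus_ge0 (T (c + r))).
  rewrite -/q => /le_trans; apply.
  have F0 := sumY phi A c phi0 AE; have G0 := sumY psi B c psi0 BE.
  set F := \sum_(z <- Y) phi (c + z) in F0 *.
  set G := \sum_(z <- Y) psi (c + z) in G0 *.
  have FF : 0 <= F by case/andP: F0.
  have GG : 0 <= G by case/andP: G0.
  have hF := power_mean_root Y (ltW p1) (fun z => modulus_ge0 (f (c + z))).
  have hG := power_mean_root Y (ltW p1) (fun z => modulus_ge0 (g (c + z))).
  have sumT : \sum_(r <- Q) modulus (T (c + r)) <= X * (F * G) `^ p^-1.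
    apply: le_trans (hC lam M f g c lam0 _) _; first by rewrite Ml.
    have -> : X * (F * G) `^ p^-1 = C / M%:R ^+ d *
        (y `^ (1 - p^-1) * F `^ p^-1) * (y `^ (1 - p^-1) * G `^ p^-1).
      rewrite /X powRM//.
      have -> : 2 - 2 / p = (1 - p^-1) + (1 - p^-1) by field; rewrite gt_eqF.
      rewrite powRD; last by rewrite -mulr2n mulrn_eq0 /= subr_eq0 eq_sym invr_eq1 gt_eqF.
      move: (C / _) (y `^ _) (F `^ _) (G `^ _) => a b e h.
      by clear; ring.
    apply: ler_pM hG; last first.
    - by apply: ler_wpM2l hF; rewrite divr_ge0 ?exprn_ge0 ?(ltW C0).
    - by apply: sumr_ge0 => z _; exact: modulus_ge0.
    rewrite mulr_ge0 ?divr_ge0 ?exprn_ge0 ?(ltW C0)//.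
    by apply: sumr_ge0 => z _; exact: modulus_ge0.
  have S0 : 0 <= \sum_(r <- Q) modulus (T (c + r)).
    by apply: sumr_ge0 => z _; exact: modulus_ge0.
  have sumTs : (\sum_(r <- Q) modulus (T (c + r))) `^ s <=
      X `^ s * ((A * B) `^ (s / p) * ((F / A + G / B) / 2)).
    apply: le_trans (ge0_ler_powR (ltW s0) _ _ sumT) _; rewrite ?nnegrE//.
      by rewrite mulr_ge0 ?powR_ge0.
    rewrite powRM ?powR_ge0// ler_wpM2l ?powR_ge0// -powRrM [p^-1 * s]mulrC.
    apply: powR_prod_le => //.
    by rewrite ler_pdivlMr// mulrC.
  apply: le_trans (ler_wpM2l (powR_ge0 _ _) sumTs) _.
  rewrite /W le_eqVlt; apply/orP; left; apply/eqP.
  move: (q `^ (1 - s)) (X `^ s) ((A * B) `^ (s / p)) A^-1 B^-1 => a b e i j.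
  by clear; field.
have cancel D : W / 2 / D * (y * D) <= W / 2 * y.
  have [->|D0] := eqVneq D 0; first by rewrite !mulr0 mulr_ge0// divr_ge0.
  by rewrite [y * D]mulrC mulrA divfK.
have tauq : (q%:E * (\esum_(x in [set: 'rV[int]_d]) (tau x)%:E) <= (W * y)%:E)%E.
  rewrite -esum_translates//.
  apply: (@le_trans _ _ (\esum_(c in [set: 'rV[int]_d])
    ((W / 2 / A)%:E * \sum_(z <- Y) (phi (c + z))%:E +
     (W / 2 / B)%:E * \sum_(z <- Y) (psi (c + z))%:E))%E).
    by apply: le_esum => c _; rewrite !sumEFin -!EFinM -EFinD lee_fin.
  have WA : 0 <= W / 2 / A by rewrite !divr_ge0.
  have WB : 0 <= W / 2 / B by rewrite !divr_ge0.
  have sphi c : (0 <= \sum_(z <- Y) (phi (c + z))%:E)%E by exact: sume_ge0.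
  have spsi c : (0 <= \sum_(z <- Y) (psi (c + z))%:E)%E by exact: sume_ge0.
  rewrite esumD; [|by move=> c _; rewrite mule_ge0..].
  apply: (@le_trans _ _ ((W / 2 / A)%:E * (y%:E * A%:E) +
                         (W / 2 / B)%:E * (y%:E * B%:E))%E).
    rewrite AE BE -!esum_translates//.
    by apply: leeD; exact: esum_mul_le.
  rewrite -!EFinM -EFinD lee_fin; apply: le_trans (lerD (cancel A) (cancel B)) _.
  by rewrite -mulrDl -splitr.
have tauE : (\esum_(x in [set: 'rV[int]_d]) (tau x)%:E <= (W * y / q)%:E)%E.
  by rewrite mulrC EFinM lee_pdivlMl.
have Wyq : W * y / q <=
    (C' * lam%:R `^ (d%:R / (2 * s) - d%:R / p) * A `^ p^-1 * B `^ p^-1) `^ s.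
  have -> : W * y / q = q `^ (1 - s) * X `^ s * y / q * (A * B) `^ (s / p).
    rewrite /W; move: (q `^ _) (X `^ _) ((A * B) `^ _) q^-1 => a b e j.
    by clear; ring.
  have Clam : 0 <= C' * lam%:R `^ (d%:R / (2 * s) - d%:R / p).
    by rewrite mulr_ge0 ?powR_ge0// ltW.
  have -> u : u * A `^ p^-1 * B `^ p^-1 = u * (A * B) `^ p^-1.
    by rewrite powRM// mulrA.
  rewrite (powRM _ Clam (powR_ge0 _ _)) -powRrM [p^-1 * s]mulrC.
  apply: ler_wpM2r; first exact: powR_ge0.
  by apply: hC' => //; rewrite y0 yM.
rewrite -!EFinM; apply: (@le_trans _ _ (poweR (W * y / q)%:E s^-1)).
  apply: gt0_ler_poweR => //; rewrite ?invr_ge0 ?(ltW s0)//.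
    by rewrite in_itv/= leey andbT; apply: esum_ge0 => x _; exact: tau0.
  rewrite in_itv/= leey andbT lee_fin.
  by rewrite (divr_ge0 (mulr_ge0 W0 y0) (ltW q0)).
rewrite poweR_EFin lee_fin.
have rhs0 : 0 <= C' * lam%:R `^ (d%:R / (2 * s) - d%:R / p) * A `^ p^-1 * B `^ p^-1.
  by rewrite !mulr_ge0 ?powR_ge0// ltW.
have root u : 0 <= u -> u = (u `^ s) `^ s^-1.
  by move=> u0; rewrite -powRrM divff ?lt0r_neq0// powRr1.
rewrite [leRHS]root//; have sV0 : 0 <= s^-1 by rewrite invr_ge0 ltW.
apply: (ge0_ler_powR sV0 _ _ Wyq); rewrite nnegrE; last exact: powR_ge0.
exact: (divr_ge0 (mulr_ge0 W0 y0) (ltW q0)).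
Qed.
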